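(* There exists an absolute constant $C>0$ such that the following holds. Let $d\leq n$ and let $X\in\mathbb{R}^{n\times d}$ be a random matrix whose rows $\mathbf{x}_1^\top,\ldots,\mathbf{x}_n^\top$ are i.i.d. random vectors. Let $\Sigma:=\mathbb{E}\left[\frac{1}{n}X^\top X\right]\in\mathbb{R}^{d\times d}$, assume that $\Sigma$ is invertible, and let $\hat{\Sigma}:=\frac{1}{n}X^\top X$. Assume further that the $\mathbf{x}_i$ are mean-zero and that $\mathbf{z}_i:=\Sigma^{-1/2}\mathbf{x}_i$ are sub-gaussian, with $K:=\max_i\|\mathbf{z}_i\|_{\psi_2}$. Then for any $t\geq 0$, with probability at least $1-2\exp(-t^2)$ it holds that for all $i\in[d]$, $$\left|\lambda_i(\hat\Sigma)- \lambda_i(\Sigma)\right| \leq CK^2 \lambda_i(\Sigma)\max\left(\epsilon, \epsilon^2\right), \qquad \text{where}\quad \epsilon:=\sqrt{\frac{d}{n}}+\frac{t}{\sqrt{n}}.$$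
   Context: $\lambda_i(\cdot)$ denotes the $i$-th largest eigenvalue of a symmetric matrix ($\lambda_1\geq\lambda_2\geq\dots$), and $[d]=\{1,\ldots,d\}$. A random vector $\mathbf{z}\in\mathbb{R}^d$ (or random variable when $d=1$) is sub-gaussian if $$\|\mathbf{z}\|_{\psi_2}:=\sup_{\mathbf{u}:\|\mathbf{u}\|=1}\ \sup_{p\geq 1}\frac{1}{\sqrt{p}}\left(\mathbb{E}\left[|\langle \mathbf{z}, \mathbf{u}\rangle|^p\right]\right)^{1/p}<\infty,$$ where $\|\mathbf{u}\|$ is the Euclidean norm. *)

(* Defs.v *)
From mathcomp Require Import all_boot all_order all_algebra.
From mathcomp Require Import all_classical all_reals all_analysis.

Set Implicit Arguments.
Unset Strict Implicit.
Unset Printing Implicit Defensive.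

Import Order.TTheory GRing.Theory Num.Theory.
Import numFieldNormedType.Exports.

Local Open Scope classical_set_scope.
Local Open Scope ring_scope.

Section LinearAlgebra.
Context {R : realType}.

Definition inner {d} (u v : 'cV[R]_d) : R := \sum_(j < d) u j 0 * v j 0.

(* The library's norm on matrices is the sup norm, hence this definition. *)
Definition norm2 {d} (u : 'cV[R]_d) : R := Num.sqrt (inner u u).

(* The eigenvalues of A repeated with algebraic multiplicity, in nonincreasing
   order. Such a sequence is unique, and it exists when A is symmetric; the
   default value [::] is only reached when A does not split over R. *)
Definition eigenvalues {d} (A : 'M[R]_d) : seq R :=
  xget [::] [set s : seq R | sorted >=%R s /\
                             char_poly A = \prod_(a <- s) ('X - a%:P)].

(* Indices start at 0: lambda A i is the (i+1)-st largest eigenvalue of A. *)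
Definition lambda {d} (A : 'M[R]_d) (i : 'I_d) : R := nth 0 (eigenvalues A) i.

Definition psd {d} (A : 'M[R]_d) : Prop :=
  A^T = A /\ forall u : 'cV[R]_d, 0 <= inner u (A *m u).

(* The positive semidefinite square root, unique if it exists; it exists
   when A is itself positive semidefinite. *)
Definition sqrtmx {d} (A : 'M[R]_d) : 'M[R]_d :=
  xget 0 [set S : 'M[R]_d | psd S /\ S *m S = A].

Definition second_moment {n d} (X : 'M[R]_(n, d)) : 'M[R]_d :=
  n%:R^-1 *: (X^T *m X).

End LinearAlgebra.

Section RandomVectors.
Context {dT : measure_display} {T : measurableType dT} {R : realType}.
Variable P : probability T R.

Definition borel {d} : set (set 'cV[R]_d) := <<s [set U | open U] >>.

Definition random_vector {d} (x : T -> 'cV[R]_d) : Prop :=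
  forall B, borel B -> measurable (x @^-1` B).

Definition independent {n d} (x : 'I_n -> T -> 'cV[R]_d) : Prop :=
  forall (J : {set 'I_n}) (B : 'I_n -> set 'cV[R]_d),
    (forall i, borel (B i)) ->
    P [set w | forall i, i \in J -> B i (x i w)] =
    (\prod_(i in J) P (x i @^-1` B i))%E.

Definition identically_distributed {n d} (x : 'I_n -> T -> 'cV[R]_d) : Prop :=
  forall i j B, borel B -> P (x i @^-1` B) = P (x j @^-1` B).

Definition iid {n d} (x : 'I_n -> T -> 'cV[R]_d) : Prop :=
  [/\ forall i, random_vector (x i), independent x & identically_distributed x].

Definition integrable_mx {m k} (M : T -> 'M[R]_(m, k)) : Prop :=
  forall i j, P.-integrable setT (fun w => (M w i j)%:E).

(* Entrywise expectation; meaningful under integrable_mx M. *)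
Definition expect_mx {m k} (M : T -> 'M[R]_(m, k)) : 'M[R]_(m, k) :=
  \matrix_(i, j) fine (expectation P (fun w => M w i j)).

Definition psi2_norm {d} (z : T -> 'cV[R]_d) : \bar R :=
  ereal_sup [set y | exists u : 'cV[R]_d, exists p : R,
    [/\ norm2 u = 1, 1 <= p &
        y = ((Num.sqrt p)^-1%:E * 'N[P]_p%:E[ (fun w => (inner (z w) u)%:E) ])%E]].

Definition sub_gaussian {d} (z : T -> 'cV[R]_d) : Prop :=
  (psi2_norm z < +oo)%E.

End RandomVectors.

(* Main.v *)
(** For z_i = Sigma^(-1/2) x_i the sample covariance A = 1/n sum_i z_i z_i^T
    has mean 1, and it suffices to show |u^T A u - u^T u| <= b u^T u for all u,
    with b = C K^2 max(eps, eps^2). Substituting u = Sigma^(1/2) v this says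
    (1 - b) Sigma <= Sigma_hat <= (1 + b) Sigma in the Loewner order, and the
    Courant-Fischer argument transfers it to the ordered eigenvalues.

    For a fixed u of norm at most 1, the moment bounds E <z_i, u>^(2k) <=
    (2 k K^2)^k control the exponential moments of <z_i, u>^2, and the Chernoff
    method with independence gives a Bernstein inequality. A union bound over a
    lattice net of the sphere with at most 2^(18 d) points makes it uniform in u.
    Only the average of the second moments of the z_i enters, which Sigma fixes.

    [P] is a set function without monotonicity off the measurable sets, so the
    event itself must be shown measurable: the eigenvalues are Lipschitz in the
    entries of a symmetric matrix, so rational matrices describe their level
    sets. *)

Require Import Defs.
From mathcomp Require Import all_boot all_order all_algebra.
From mathcomp Require Import all_classical all_reals all_analysis.
From mathcomp Require Import measurable_realfun complex spectral perm ring lra.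

Set Implicit Arguments.
Unset Strict Implicit.
Unset Printing Implicit Defensive.

Import Order.TTheory GRing.Theory Num.Theory.
Import numFieldNormedType.Exports.

Local Open Scope classical_set_scope.
Local Open Scope ring_scope.

(** * Real symmetric matrices *)

(** Over the complex numbers the matrix becomes Hermitian, and its spectral diagonal is real. The
    first diagonal entry is then a root of the characteristic polynomial already over [R]. *)
Lemma symmetric_eigenvalue (R : rcfType) n (A : 'M[R]_n) :
  (0 < n)%N -> A^T = A -> exists a, eigenvalue A a.
Proof.
move=> n0 AT; pose f := real_complex R; pose B := map_mx f A.
have Bh : B \is hermsymmx.
  apply: realsym_hermsym.
    apply/is_hermitianmxP; rewrite expr0 scale1r map_mx_id //.
    by rewrite /B -{1}AT; apply/matrixP => i j; rewrite !mxE.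
  by apply/mxOverP => i j; rewrite mxE complex_real.
have /orthomx_spectralP BE := hermitian_normalmx Bh.
have /mxOverP := hermitian_spectral_diag_real Bh.
set P := spectralmx B in BE; set D := spectral_diag B in BE *.
pose i := Ordinal n0; move=> /(_ 0 i) /RRe_real DR.
exists (complex.Re (D 0 i)); rewrite eigenvalue_root_char -(fmorph_root f) map_char_poly.
rewrite -/B -eigenvalue_root_char; apply/eigenvalueP; exists (row i P).
  rewrite {1}BE -!mulmxA -row_mul mulKVmx ?spectral_unit //.
  rewrite mul_diag_mx; apply/rowP => j; rewrite !mxE.
  by rewrite -[in LHS]DR.
apply/eqP => /(congr1 (fun v => v *m invmx P)).
rewrite -row_mul mulmxV ?spectral_unit// mul0mx => /rowP /(_ i).
by rewrite !mxE eqxx => /eqP; rewrite oner_eq0.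
Qed.

Lemma mulmx_tr_gt0 (R : realDomainType) n (v : 'rV[R]_n) :
  v != 0 -> 0 < (v *m v^T) 0 0.
Proof.
move=> v0; rewrite mxE; have vi i : v 0 i * v^T i 0 = v 0 i ^+ 2 by rewrite mxE.
rewrite lt0r sumr_ge0 ?andbT; last by move=> i _; rewrite vi sqr_ge0.
apply: contra v0; rewrite psumr_eq0; last by move=> i _; rewrite vi sqr_ge0.
move=> /allP vi0; apply/eqP/rowP => i; rewrite mxE; apply/eqP.
by have := vi0 i (mem_index_enum i); rewrite vi sqrf_eq0.
Qed.

(* The reflection exchanging v with the first basis vector. *)
Lemma householder (R : rcfType) n (v : 'rV[R]_n.+1) : v *m v^T = 1%:M ->
  exists H : 'M[R]_n.+1, [/\ H^T = H, H *m H = 1%:M & delta_mx 0 0 *m H = v].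
Proof.
move=> vv; pose e : 'rV[R]_n.+1 := delta_mx 0 0.
have [w wE] : exists w, w = v - e by exists (v - e).
have ee : e *m e^T = 1%:M.
  by rewrite trmx_delta mul_delta_mx; apply/matrixP => i j; rewrite !ord1 !mxE.
have [/eqP|w0] := eqVneq w 0.
  rewrite wE subr_eq0 => /eqP ve; exists 1%:M; split; rewrite ?trmx1 ?mulmx1//.
pose c := (w *m w^T) 0 0; have wwE : w *m w^T = c%:M by exact: mx11_scalar.
(* As v and e both have norm one, w w^T = 2 - 2 e v^T = 2 w v^T. This is what makes the reflection
   along w send v to e. *)
have wv : w *m v^T = (c / 2)%:M.
  have ev : e *m v^T = v *m e^T.
    by rewrite -[RHS]trmxK trmx_mul trmxK; apply/matrixP => i j; rewrite !ord1 [RHS]mxE.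
  have : w *m w^T = w *m v^T + w *m v^T.
    rewrite wE linearB /= !mulmxBl !mulmxBr vv ee ev.
    by apply/matrixP => i j; rewrite !mxE; ring.
  rewrite wwE => /matrixP /(_ 0 0); rewrite [in RHS]mxE [LHS]mxE eqxx mulr1n => ->.
  by rewrite [LHS]mx11_scalar; congr (_%:M); field.
have c0 : c != 0 by rewrite gt_eqF// mulmx_tr_gt0.
pose H := 1%:M - (2 / c) *: (w^T *m w).
have HT : H^T = H by rewrite /H linearB /= trmx1 linearZ /= trmx_mul trmxK.
have HH : H *m H = 1%:M.
  rewrite /H mulmxBl mul1mx mulmxBr mulmx1 -scalemxAl -scalemxAr.
  rewrite mulmxA -(mulmxA w^T) wwE mul_mx_scalar -scalemxAl.
  move: (w^T *m w) c0 => N c0; apply/matrixP => i j; rewrite !mxE.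
  by move: (_ == _)%:R (N i j) => x y; field.
exists H; split => //; rewrite -/e.
have <- : v *m H = e; last by rewrite -mulmxA HH mulmx1.
rewrite /H mulmxBr mulmx1 -scalemxAr mulmxA.
have -> : v *m w^T = (c / 2)%:M by rewrite -[LHS]trmxK trmx_mul trmxK wv tr_scalar_mx.
rewrite mul_scalar_mx scalerA.
have -> : 2 / c * (c / 2) = 1 by field.
by rewrite scale1r wE opprB addrC subrK.
Qed.

(** Induction on the dimension: conjugating by a reflection that moves a unit eigenvector to the
    first basis vector clears the first row, and by symmetry the first column, leaving a smaller
    symmetric block. *)
Lemma symmetric_diagonalization (R : rcfType) n (A : 'M[R]_n) : A^T = A ->
  exists (Q : 'M[R]_n) (D : 'rV[R]_n),
    Q *m Q^T = 1%:M /\ A = Q^T *m diag_mx D *m Q.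
Proof.
elim: n A => [|n IH] A AT.
  by exists 1%:M, 0; split; apply/matrixP => -[].
have [a /eigenvalueP[u uA u0]] := symmetric_eigenvalue (ltn0Sn n) AT.
pose c := (u *m u^T) 0 0.
have c_gt0 : 0 < c by exact: mulmx_tr_gt0.
pose v := (Num.sqrt c)^-1 *: u.
have vA : v *m A = a *: v by rewrite /v -scalemxAl uA !scalerA mulrC.
have vv : v *m v^T = 1%:M.
  rewrite /v linearZ /= -scalemxAl -scalemxAr scalerA (mx11_scalar (u *m u^T)) -/c.
  rewrite scale_scalar_mx -expr2 exprVn sqr_sqrtr ?ltW// mulVf ?gt_eqF//.
case: (householder vv) => H [HT HH eH].
have [B BE0] : exists B : 'M[R]_(1 + n), B = H *m A *m H by eexists.
have BT : B^T = B by rewrite BE0 !trmx_mul HT AT mulmxA.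
have eB : delta_mx 0 0 *m B = a *: (delta_mx 0 0 : 'rV_n.+1).
  by rewrite BE0 !mulmxA eH vA -scalemxAl -eH -mulmxA HH mulmx1.
have Burl : ursubmx B = 0.
  apply/rowP => j; have /rowP/(_ (rshift 1 j)) := eB.
  rewrite -rowE [LHS]mxE [RHS]mxE [X in _ * X]mxE mulr0 => h.
  by rewrite !mxE lshift0 h.
have Bul : ulsubmx B = a%:M.
  apply/rowP => j; have /rowP/(_ 0) := eB.
  rewrite -rowE [LHS]mxE [RHS]mxE [X in _ * X]mxE !eqxx mulr1 => h.
  by rewrite !mxE !ord1 lshift0 h.
have Bdl : dlsubmx B = 0 by rewrite -BT -trmx_ursub Burl trmx0.
have [Q [D [QQ DE]]] := IH (drsubmx B) (etrans (trmx_drsub B) (congr1 _ BT)).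
have BE : B = block_mx a%:M 0 0 (drsubmx B) by rewrite -{1}(submxK B) Burl Bul Bdl.
pose Q1 : 'M[R]_(1 + n) := block_mx 1%:M 0 0 Q.
have Q1T : Q1^T = block_mx 1%:M 0 0 Q^T.
  by rewrite /Q1 tr_block_mx !trmx0 trmx1.
have QQ1 : Q1 *m Q1^T = 1%:M.
  rewrite Q1T mulmx_block !(mulmx0, mul0mx, addr0, add0r) mulmx1 QQ.
  by rewrite -scalar_mx_block.
have BQ : B = Q1^T *m diag_mx (row_mx a%:M D) *m Q1.
  rewrite Q1T BE DE diag_mx_row !mulmx_block.
  rewrite !(mulmx0, mul0mx, addr0, add0r, mulmx1, mul1mx).
  by congr (block_mx _ _ _ _); apply/matrixP => i j; rewrite !ord1 !mxE eqxx.
exists (Q1 *m H), (row_mx a%:M D); split.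
  by rewrite trmx_mul HT mulmxA -(mulmxA Q1) HH mulmx1.
have -> : A = H *m B *m H.
  by rewrite BE0 !mulmxA HH mul1mx -mulmxA HH mulmx1.
by rewrite trmx_mul HT {1}BQ !mulmxA.
Qed.

(** * Ordered eigenvalues *)

Section QuadraticForms.
Context {R : realType}.

Lemma innerE d (u v : 'cV[R]_d) : inner u v = (u^T *m v) 0 0.
Proof. by rewrite mxE; apply: eq_bigr => i _; rewrite mxE. Qed.

Lemma inner_ge0 d (u : 'cV[R]_d) : 0 <= inner u u.
Proof. by apply: sumr_ge0 => i _; rewrite -expr2 sqr_ge0. Qed.

Lemma inner_gt0 d (u : 'cV[R]_d) : u != 0 -> 0 < inner u u.
Proof.
by move=> u0; rewrite innerE -{2}(trmxK u) mulmx_tr_gt0// trmx_eq0.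
Qed.

Lemma inner_mulmx d k (M : 'M[R]_(d, k)) (u : 'cV[R]_d) (v : 'cV[R]_k) :
  inner u (M *m v) = inner (M^T *m u) v.
Proof. by rewrite !innerE trmx_mul trmxK mulmxA. Qed.

Lemma char_poly_conj d (Q A : 'M[R]_d) : Q *m Q^T = 1%:M ->
  char_poly (Q^T *m A *m Q) = char_poly A.
Proof.
move=> QQ; have QQ' : Q^T *m Q = 1%:M by exact: mulmx1C.
rewrite /char_poly.
have -> : char_poly_mx (Q^T *m A *m Q) =
    map_mx polyC Q^T *m char_poly_mx A *m map_mx polyC Q.
  rewrite /char_poly_mx mulmxBr mulmxBl !map_mxM; congr (_ - _).
  by rewrite mul_mx_scalar -scalemxAl -map_mxM QQ' map_mx1 scalemx1.
rewrite !det_mulmx mulrC mulrA -det_mulmx -map_mxM QQ map_mx1 det1 mul1r //.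
Qed.

(** The sorted diagonal of an orthogonal diagonalization has the defining property, so [xget] does
    not return its default. *)
Lemma eigenvaluesP d (A : 'M[R]_d) : A^T = A ->
  sorted >=%R (eigenvalues A) /\
  char_poly A = \prod_(a <- eigenvalues A) ('X - a%:P).
Proof.
move=> /symmetric_diagonalization [Q [D [QQ ->]]].
pose s := [seq D 0 i | i <- enum 'I_d].
rewrite /eigenvalues; case: xgetP => [_ -> //|/(_ (sort >=%R s))].
case; split; first by apply: sort_sorted => x y; rewrite orbC le_total.
rewrite char_poly_conj // char_poly_trig ?diag_mx_is_trig //.
rewrite (perm_big s) ?perm_sort //= big_map big_enum /=.
by apply: eq_bigr => i _; rewrite mxE eqxx mulr1n.
Qed.

Lemma size_eigenvalues d (A : 'M[R]_d) : A^T = A -> size (eigenvalues A) = d.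
Proof.
move=> /eigenvaluesP[_ cA]; apply/eqP.
by rewrite -(eqn_add2r 1) !addn1 -(size_prod_XsubC _ id) -cA size_char_poly.
Qed.

(** Unique factorization of the characteristic polynomial makes the diagonal of any diagonalization
    a permutation of [eigenvalues A]. Permuting the rows of Q accordingly puts it in order. *)
Lemma symmetric_spectral d (A : 'M[R]_d) : A^T = A ->
  exists Q : 'M[R]_d, Q *m Q^T = 1%:M /\
    A = Q^T *m diag_mx (\row_i lambda A i) *m Q.
Proof.
move=> AT; have [_ cA] := eigenvaluesP AT.
have [Q [D [QQ AE]]] := symmetric_diagonalization AT.
pose s := [tuple D 0 i | i < d].
have /eqP es := size_eigenvalues AT.
have : perm_eq (Tuple es) s.
  apply: prod_XsubC_eq; rewrite -cA {1}AE char_poly_conj //.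
  rewrite char_poly_trig ?diag_mx_is_trig // /s big_map big_enum /=.
  by apply: eq_bigr => i _; rewrite mxE eqxx mulr1n.
case/tuple_permP => p; rewrite [tval _]/= => pE.
have lE i : lambda A i = D 0 (p i).
  by rewrite /lambda pE -tnth_nth !tnth_mktuple.
have QQ' : (row_perm p Q) *m (row_perm p Q)^T = 1%:M.
  rewrite row_permE trmx_mul mulmxA -(mulmxA (perm_mx p)) QQ mulmx1.
  by rewrite tr_perm_mx -perm_mxM mulgV perm_mx1.
exists (row_perm p Q); split => //.
rewrite {1}AE; apply/matrixP => i j; rewrite !mul_mx_diag.
rewrite !mxE (reindex_inj (@perm_inj _ p)) /=.
by apply: eq_bigr => k _; rewrite !mxE lE.
Qed.

Lemma lambda_nonincreasing d (A : 'M[R]_d) (i j : 'I_d) : A^T = A -> (i <= j)%N ->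
  lambda A j <= lambda A i.
Proof.
move=> AT ij; have [sA _] := eigenvaluesP AT.
have es := size_eigenvalues AT.
have tr : transitive (>=%R : rel R) by move=> x y z yx zy; exact: le_trans zy yx.
apply: (sorted_leq_nth tr _ 0 sA); rewrite ?inE ?es // => x; exact: lexx.
Qed.

Lemma quadratic_spectral d (A Q : 'M[R]_d) (D : 'rV_d) u :
  A = Q^T *m diag_mx D *m Q ->
  inner u (A *m u) = \sum_k D 0 k * (Q *m u) k 0 ^+ 2.
Proof.
move=> ->; rewrite -!mulmxA inner_mulmx trmxK; apply: eq_bigr => k _.
by rewrite mul_diag_mx [X in _ * X]mxE mulrCA -expr2.
Qed.

Lemma inner_orthogonal d (Q : 'M[R]_d) (u v : 'cV[R]_d) : Q *m Q^T = 1%:M ->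
  inner (Q *m u) (Q *m v) = inner u v.
Proof. by move=> QQ; rewrite inner_mulmx mulmxA (mulmx1C QQ) mul1mx. Qed.

(* Courant-Fischer: the span of the first i+1 eigenvectors of A meets the span
   of the last d-i eigenvectors of B. *)
Lemma lambda_le_quadratic d (A B : 'M[R]_d) (a b : R) (i : 'I_d) :
  A^T = A -> B^T = B -> 0 <= a ->
  (forall u, inner u (A *m u) <= a * inner u (B *m u) + b * inner u u) ->
  lambda A i <= a * lambda B i + b.
Proof.
move=> AT BT a0 AB.
have [QA [QQA AE]] := symmetric_spectral AT.
have [QB [QQB BE]] := symmetric_spectral BT.
have QAf : row_free QA by rewrite row_free_unit; case/mulmx1_unit: QQA.
have QBf : row_free QB by rewrite row_free_unit; case/mulmx1_unit: QQB.
pose V : 'M[R]_d := pid_mx i.+1 *m QA; pose W : 'M[R]_d := copid_mx i *m QB.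
have rV : \rank V = i.+1 by rewrite mxrankMfree// rank_pid_mx.
have rW : \rank W = (d - i)%N by rewrite mxrankMfree// rank_copid_mx // ltnW.
(* With [i] counted from 0 the ranks are i + 1 and d - i. They add up to d + 1, one more than the
   ambient dimension. *)
have : (V :&: W)%MS != 0.
  rewrite -mxrank_eq0; apply: contraPneq (mxrank_sum_cap V W) => ->.
  rewrite rV rW addn0 addSn subnKC; last exact: ltnW.
  by move=> rVW; have := rank_leq_row (V + W)%MS; rewrite rVW ltnn.
case/rowV0Pn => r; rewrite sub_capmx => /andP[/submxP[x rx] /submxP[y ry]] r0.
pose u := r^T.
have uA (k : 'I_d) : (i < k)%N -> (QA *m u) k 0 = 0.
  move=> ik; have -> : QA *m u = (x *m pid_mx i.+1)^T.
    by rewrite /u rx !trmx_mul !mulmxA QQA mul1mx.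
  rewrite !mxE big1 // => l _; rewrite !mxE ltnS.
  by case: eqP => [->|]; rewrite ?mulr0// leqNgt ik mulr0.
have uB (k : 'I_d) : (k < i)%N -> (QB *m u) k 0 = 0.
  move=> ik; have -> : QB *m u = (y *m copid_mx i)^T.
    by rewrite /u ry !trmx_mul !mulmxA QQB mul1mx.
  rewrite !mxE big1 // => l _; rewrite !mxE.
  rewrite -val_eqE /=; case: eqP => [->|_]; first by rewrite ik subrr mulr0.
  by rewrite subr0 mulr0.
have lowA : lambda A i * inner u u <= inner u (A *m u).
  rewrite (quadratic_spectral _ AE) -(inner_orthogonal _ _ QQA) mulr_sumr.
  apply: ler_sum => k _; rewrite [X in _ <= X * _]mxE -expr2.
  have [ki|ik] := leqP k i; last by rewrite uA// expr0n !mulr0.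
  by rewrite ler_wpM2r ?sqr_ge0// lambda_nonincreasing.
have uppB : inner u (B *m u) <= lambda B i * inner u u.
  rewrite (quadratic_spectral _ BE) -(inner_orthogonal _ _ QQB) mulr_sumr.
  apply: ler_sum => k _; rewrite [X in X * _]mxE -expr2.
  have [ik|ki] := leqP i k; last by rewrite uB// expr0n !mulr0.
  by rewrite ler_wpM2r ?sqr_ge0// lambda_nonincreasing.
have u0 : 0 < inner u u by rewrite inner_gt0// trmx_eq0.
rewrite -(ler_pM2r u0) mulrDl (le_trans lowA)// (le_trans (AB u))//.
by rewrite lerD2r -mulrA ler_wpM2l.
Qed.

Lemma innerDl d (u v w : 'cV[R]_d) : inner (u + v) w = inner u w + inner v w.
Proof. by rewrite !innerE linearD mulmxDl mxE. Qed.

Lemma innerC d (u v : 'cV[R]_d) : inner u v = inner v u.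
Proof. by apply: eq_bigr => i _; rewrite mulrC. Qed.

Lemma innerDr d (u v w : 'cV[R]_d) : inner w (u + v) = inner w u + inner w v.
Proof. by rewrite innerC innerDl !(innerC w). Qed.

Lemma innerZl d (a : R) (u v : 'cV[R]_d) : inner (a *: u) v = a * inner u v.
Proof. by rewrite !innerE linearZ /= -scalemxAl mxE. Qed.

Lemma innerZr d (a : R) (u v : 'cV[R]_d) : inner u (a *: v) = a * inner u v.
Proof. by rewrite innerC innerZl innerC. Qed.

Lemma lambda_eigenvector d (A : 'M[R]_d) (i : 'I_d) : A^T = A ->
  exists2 u : 'cV[R]_d, inner u u = 1 & A *m u = lambda A i *: u.
Proof.
move=> /symmetric_spectral[Q [QQ AE]]; exists (Q^T *m delta_mx i 0).
  rewrite -(inner_orthogonal _ _ QQ) mulmxA QQ mul1mx innerE.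
  by rewrite trmx_delta mul_delta_mx mxE !eqxx.
rewrite {1}AE -!mulmxA (mulmxA Q) QQ mul1mx scalemxAr; congr (_ *m _).
apply/colP => k; rewrite mul_diag_mx !mxE eqxx andbT.
by case: eqVneq => [->|]; rewrite ?mulr0.
Qed.

Lemma lambda_ge0 d (A : 'M[R]_d) (i : 'I_d) : psd A -> 0 <= lambda A i.
Proof.
move=> [AT A0]; have [u u1 Au] := lambda_eigenvector i AT.
by have := A0 u; rewrite Au innerZr u1 mulr1.
Qed.

(** Taking square roots of the eigenvalues in an orthonormal eigenbasis gives a witness, which rules
    out the default of [xget]. *)
Lemma sqrtmxP d (A : 'M[R]_d) : psd A ->
  psd (sqrtmx A) /\ sqrtmx A *m sqrtmx A = A.
Proof.
move=> Apsd; rewrite /sqrtmx; case: xgetP => [_ -> //|].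
have [Q [QQ AE]] := symmetric_spectral (proj1 Apsd).
pose D : 'rV[R]_d := \row_i Num.sqrt (lambda A i).
move=> /(_ (Q^T *m diag_mx D *m Q))[]; split; first split.
- by rewrite !trmx_mul trmxK tr_diag_mx mulmxA.
- move=> u; rewrite (quadratic_spectral _ erefl); apply: sumr_ge0 => k _.
  by rewrite mulr_ge0 ?sqr_ge0// mxE sqrtr_ge0.
rewrite -!mulmxA (mulmxA Q) QQ mul1mx (mulmxA (diag_mx D)) mulmx_diag [RHS]AE !mulmxA.
congr (_ *m diag_mx _ *m _); apply/rowP => i.
by rewrite !mxE -expr2 sqr_sqrtr ?lambda_ge0.
Qed.

Lemma quadratic_le d (A : 'M[R]_d) (s : R) (u : 'cV[R]_d) : A^T = A ->
  (forall i, `|lambda A i| <= s) -> `|inner u (A *m u)| <= s * inner u u.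
Proof.
move=> AT As; have [Q [QQ AE]] := symmetric_spectral AT.
rewrite (quadratic_spectral _ AE) -(inner_orthogonal _ _ QQ) mulr_sumr.
rewrite (le_trans (ler_norm_sum _ _ _))//; apply: ler_sum => k _.
rewrite -expr2 normrM (ger0_norm (sqr_ge0 _)) ler_wpM2r ?sqr_ge0//.
by rewrite mxE.
Qed.

(* Testing on an eigenvector x of the eigenvalue l of largest modulus: for
   y = x + h, y^T A y = l + 2 l h^T x + h^T A h with |h^T A h| <= |l| h^T h. *)
Lemma quadratic_net d (A : 'M[R]_d) (N : seq 'cV[R]_d) (b : R) : A^T = A ->
  (forall x, inner x x = 1 ->
     exists2 y, y \in N & inner (y - x) (y - x) <= 16^-1) ->
  (forall y, y \in N -> `|inner y (A *m y)| <= b) ->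
  forall u, `|inner u (A *m u)| <= 3 * b * inner u u.
Proof.
case: d A N => [|d] A N AT Nnet Nb u.
  by rewrite /inner !big_ord0 normr0 mulr0.
pose i := [arg max_(i > ord0) `|lambda A i|]%O.
have si j : `|lambda A j| <= `|lambda A i|.
  by rewrite /i; case: Order.TotalTheory.arg_maxP => // k _; apply.
have [x x1 Ax] := lambda_eigenvector i AT.
have [y yN] := Nnet x x1.
have : y = x + (y - x) by rewrite addrC subrK.
move: (y - x) => h yE h16.
have h0 := inner_ge0 h.
have hA := quadratic_le h AT si.
(* The squared norms of 2 h + x / 2 and 2 h - x / 2 are nonnegative, so 2 |h^T x| <= 4 / 16 + 1 /
   4. *)
have hx : `|inner h x| <= 4^-1.
  have := inner_ge0 (2 *: h + 2^-1 *: x); have := inner_ge0 (2 *: h - 2^-1 *: x).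
  rewrite -scaleNr !(innerDl, innerDr, innerZl, innerZr) x1 (innerC x h) => *.
  by rewrite ler_norml; apply/andP; split; lra.
have := Nb y yN; rewrite yE mulmxDr !innerDl !innerDr (inner_mulmx A x h) AT Ax.
rewrite innerZl !innerZr x1 (innerC x h) mulr1 => H.
rewrite (le_trans (quadratic_le u AT si))//; apply: ler_wpM2r; first exact: inner_ge0.
have s0 := normr_ge0 (lambda A i).
set l := lambda A i in hA s0 H *; set s := `|l| in hA s0 H *.
have lhx : `|l * inner h x| <= s * 4^-1 by rewrite normrM ler_wpM2l.
have hA' : `|inner h (A *m h)| <= s * 16^-1 by rewrite (le_trans hA)// ler_wpM2l.
(* The right side is at most b + s / 4 + s / 4 + s / 16, so s <= 16 b / 7 <= 3 b. *)
have : s <= b + `|l * inner h x| + `|l * inner h x| + `|inner h (A *m h)|.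
  have -> : s = `|(l + l * inner h x + (l * inner h x + inner h (A *m h)))
     - l * inner h x - l * inner h x - inner h (A *m h)|.
    by congr `|_|; ring.
  rewrite (le_trans (ler_normB _ _))// lerD2r.
  rewrite (le_trans (ler_normB _ _))// lerD2r.
  by rewrite (le_trans (ler_normB _ _))// lerD2r.
by lra.
Qed.

End QuadraticForms.

(** * A net of the sphere *)

Lemma sum_geometric_le2 {R : realType} (q : R) n :
  0 <= q <= 2^-1 -> \sum_(k < n) q ^+ k <= 2.
Proof.
move=> /andP[q0 q1].
(* The bound is strengthened to the exact sum for ratio 1/2 so that the induction goes through. *)
apply: (@le_trans _ _ (2 - 2 * 2^-1 ^+ n)); last first.
  by rewrite lerBlDr lerDl mulr_ge0// exprn_ge0// invr_ge0.
elim: n => [|n IH]; first by rewrite big_ord0 expr0 mulr1 subrr.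
rewrite big_ord_recr /=.
have : q ^+ n <= 2^-1 ^+ n by rewrite lerXn2r ?nnegrE ?invr_ge0.
by rewrite (exprS _ n); lra.
Qed.

Section SphereNet.
Context {R : realType}.

(* The pair k stands for the signed integer of absolute value k.2. *)
Lemma sum_expn_sqr_le4 (M : nat) :
  \sum_(k : bool * 'I_M) (2^-1 ^+ (k.2 ^ 2) : R) <= 4.
Proof.
have -> : \sum_(k : bool * 'I_M) (2^-1 ^+ (k.2 ^ 2) : R) =
    \sum_(b : bool) \sum_(j < M) 2^-1 ^+ (j ^ 2).
  by rewrite pair_big.
rewrite big_bool /=.
suff : \sum_(j < M) (2^-1 ^+ (j ^ 2) : R) <= 2 by move: (\sum_(j < M) _) => s; lra.
have le2 : \sum_(j < M) (2^-1 ^+ (j ^ 2) : R) <= \sum_(j < M) 2^-1 ^+ j.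
  apply: ler_sum => j _; rewrite ler_wiXn2l ?invr_ge0//.
    by rewrite invf_le1// ler1n.
  by case: (nat_of_ord j) => // k; rewrite -mulnn leq_pmulr.
by apply: (le_trans le2); apply: sum_geometric_le2; rewrite invr_ge0 lexx andbT.
Qed.

(* The net consists of the points of the lattice (4 sqrt d)^-1 Z^d in the unit
   ball. It is counted by giving the lattice point k the weight 2^-|k|^2. *)
Lemma sphere_net d : (0 < d)%N ->
  exists N : seq 'cV[R]_d,
  [/\ (size N)%:R <= 2 ^+ (18 * d) :> R,
      forall y, y \in N -> inner y y <= 1 &
      forall x, inner x x = 1 ->
        exists2 y, y \in N & inner (y - x) (y - x) <= 16^-1].
Proof.
move=> d0.
(* A coordinate k of a lattice point in the ball has k^2 <= 16 d <= (4 d)^2, so this finite range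
   suffices. *)
pose I := (bool * 'I_(4 * d).+1)%type.
pose N : {set {ffun 'I_d -> I}} :=
  finset (fun f : {ffun 'I_d -> I} => \sum_i (f i).2 ^ 2 <= 16 * d)%N.
have NE f : (f \in N) = (\sum_i (f i).2 ^ 2 <= 16 * d)%N by rewrite /N inE.
have [c cE] : exists c : R, c = 4 * Num.sqrt d%:R by eexists.
have c0 : 0 < c by rewrite cE mulr_gt0// sqrtr_gt0 ltr0n.
have c2 : c ^+ 2 = 16 * d%:R by rewrite cE exprMn sqr_sqrtr// -natrX.
pose y (f : {ffun 'I_d -> I}) : 'cV[R]_d :=
  \col_i ((-1) ^+ (f i).1 * (f i).2%:R / c).
exists [seq y f | f <- enum N]; split.
- rewrite size_map -cardE -sum1_card natr_sum /=.
  (* Points of [N] have squared norm at most 16 d, so 2^(16 d) times their weight is at least 1. The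
     total weight of all lattice points factors over the d coordinates with factors at most 4, which
     gives the exponent 16 d + 2 d. *)
  have : \sum_(f in N) (1%:R : R) <= \sum_(f : {ffun 'I_d -> I})
      2 ^+ (16 * d) * \prod_i (2^-1 ^+ ((f i).2 ^ 2)).
    rewrite big_mkcond; apply: ler_sum => f _; rewrite -expr_sum.
    rewrite NE; case: ifPn => [fN|_]; last by rewrite mulr_ge0// exprn_ge0// invr_ge0.
    by rewrite exprVn ler_pdivlMr ?exprn_gt0// mul1r ler_weXn2l// ler1n.
  move=> /le_trans; apply; rewrite -mulr_sumr.
  rewrite -(bigA_distr_bigA (fun _ (k : I) => 2^-1 ^+ (k.2 ^ 2))) /=.
  rewrite prodr_const card_ord (mulnDl 16 2 d) exprD ler_wpM2l ?exprn_ge0//.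
  rewrite exprM -natrX lerXn2r ?nnegrE ?sum_expn_sqr_le4//.
  by apply: sumr_ge0 => k _; rewrite exprn_ge0// invr_ge0.
- move=> _ /mapP[f + ->]; rewrite mem_enum NE => fN.
  rewrite /inner (_ : \sum_j _ = (\sum_j (f j).2 ^ 2)%N%:R / c ^+ 2).
    by rewrite ler_pdivrMr ?exprn_gt0// mul1r c2 -natrM ler_nat.
  rewrite natr_sum mulr_suml; apply: eq_bigr => j _.
  by rewrite !mxE -expr2 !exprMn sqrr_sign mul1r exprVn natrX.
move=> x x1.
(* Rounding each coordinate towards 0 does not increase the norm, so the lattice point stays in the
   ball. Each coordinate moves by at most 1 / c, and d / c^2 = 1 / 16. *)
pose k i := Num.truncn (c * `|x i 0|).
have kc i : (k i)%:R <= c * `|x i 0| < (k i).+1%:R.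
  by rewrite truncn_itv// mulr_ge0// ltW.
have x2 i : x i 0 ^+ 2 <= 1.
  rewrite -x1 /inner (bigD1 i)//= -expr2 lerDl sumr_ge0// => j _.
  by rewrite -expr2 sqr_ge0.
have k2 i : (k i ^ 2)%:R <= c ^+ 2 * x i 0 ^+ 2.
  rewrite -(real_normK (num_real (x i 0))) -exprMn natrX.
  by rewrite lerXn2r ?nnegrE ?(mulr_ge0 (ltW c0))//; case/andP: (kc i).
have kd i : (k i < (4 * d).+1)%N.
  rewrite ltnS -leq_sqr -(ler_nat R) (le_trans (k2 i))//.
  rewrite (le_trans (ler_wpM2l _ (x2 i))) ?sqr_ge0// mulr1 c2 -natrM ler_nat.
  by rewrite expnMn leq_mul// -mulnn leq_pmulr.
pose f : {ffun 'I_d -> I} := [ffun i => (x i 0 < 0, Ordinal (kd i))].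
exists (y f).
  apply: map_f; rewrite mem_enum NE -(ler_nat R) natr_sum.
  under eq_bigr do rewrite ffunE /=.
  rewrite (le_trans (ler_sum _ (fun i _ => k2 i)))// -mulr_sumr c2 natrM.
  suff -> : \sum_i x i 0 ^+ 2 = 1 by rewrite mulr1.
  by rewrite -x1; apply: eq_bigr => i _; rewrite expr2.
have -> : 16^-1 = \sum_(i < d) c^-1 ^+ 2 :> R.
  rewrite sumr_const card_ord -[RHS]mulr_natr exprVn c2 [in RHS]invfM.
  by rewrite -mulrA mulVf ?mulr1// pnatr_eq0 -lt0n.
apply: ler_sum => i _; rewrite -expr2 !mxE !ffunE /=.
rewrite -(real_normK (num_real (_ - _))) lerXn2r ?nnegrE ?invr_ge0 ?(ltW c0)//.
have -> : (-1) ^+ (x i 0 < 0)%R * (k i)%:R / c - x i 0 =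
    (-1) ^+ (x i 0 < 0)%R * (((k i)%:R - c * `|x i 0|) / c).
  rewrite {2}(numEsign (x i 0)).
  move: ((-1) ^+ _) (_%:R) (`|_|) => a b e.
  by field; rewrite gt_eqF.
rewrite normrM normr_sign mul1r normrM normfV (gtr0_norm c0) ler_pdivrMr//.
rewrite mulVf ?gt_eqF// distrC ger0_norm ?subr_ge0.
  by case/andP: (kc i) => _ /ltW; rewrite -natr1 lerBlDl.
by case/andP: (kc i).
Qed.

End SphereNet.

(** * Measurability of the eigenvalues *)

Section MeasurableLambda.
Context {R : realType}.

(** Each term is bounded through 2 |u_i u_j| <= u_i^2 + u_j^2, and each square then occurs 2 d times
    in the double sum. *)
Lemma quadratic_entries_le d (A : 'M[R]_d) (e : R) (u : 'cV[R]_d) :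
  (forall i j, `|A i j| <= e) -> inner u (A *m u) <= d%:R * e * inner u u.
Proof.
move=> Ae; have le2 i j : u i 0 * (A i j * u j 0) <=
    e * 2^-1 * (u i 0 ^+ 2 + u j 0 ^+ 2).
  rewrite (le_trans (ler_norm _))// !normrM mulrCA.
  rewrite (le_trans (ler_wpM2r _ (Ae i j))) ?mulr_ge0//.
  rewrite -mulrA ler_wpM2l ?(le_trans _ (Ae i j))//.
  rewrite -(real_normK (num_real (u i 0))) -(real_normK (num_real (u j 0))).
  by have := sqr_ge0 (`|u i 0| - `|u j 0|); rewrite sqrrB; lra.
have -> : inner u (A *m u) = \sum_i \sum_j u i 0 * (A i j * u j 0).
  by apply: eq_bigr => i _; rewrite mxE mulr_sumr.
apply: (le_trans (ler_sum _ (fun i _ => ler_sum _ (fun j _ => le2 i j)))).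
under eq_bigr do rewrite -mulr_sumr big_split /= sumr_const card_ord.
rewrite -mulr_sumr big_split /= sumr_const card_ord sumrMnl.
have -> : \sum_i u i 0 ^+ 2 = inner u u by apply: eq_bigr => i _; rewrite expr2.
by rewrite -[inner u u *+ d]mulr_natl le_eqVlt; apply/orP; left; apply/eqP; field.
Qed.

Lemma lambda_lipschitz d (A B : 'M[R]_d) (e : R) (k : 'I_d) :
  A^T = A -> B^T = B -> (forall i j, `|A i j - B i j| <= e) ->
  lambda A k <= lambda B k + d%:R * e.
Proof.
move=> AT BT ABe; rewrite -[lambda B k]mul1r; apply: lambda_le_quadratic => // u.
rewrite mul1r -{1}(subrK B A) mulmxDl innerDr addrC lerD2l.
by apply: quadratic_entries_le => i j; rewrite !mxE.
Qed.

(** By [lambda_lipschitz], the eigenvalue is below c exactly when some rational symmetric N is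
    within a rational q of M entrywise and satisfies lambda N + d q < c. This is a countable union
    of finite intersections of measurable sets. *)
Lemma measurable_lambda dT (T : measurableType dT) d (M : T -> 'M[R]_d)
    (k : 'I_d) :
  (forall i j, measurable_fun setT (fun w => M w i j)) ->
  (forall w, (M w)^T = M w) ->
  measurable_fun setT (fun w => lambda (M w) k).
Proof.
move=> mM MT; apply: (measurability _ (RGenInftyO.measurableE R)) => //.
move=> _ [_ [c ->] <-]; rewrite setTI.
pose r (N : 'M[rat]_d) : 'M[R]_d := map_mx ratr N.
pose ok (p : 'M[rat]_d * rat) :=
  (r p.1)^T = r p.1 /\ lambda (r p.1) k + d%:R * ratr p.2 < c.
have -> : (fun w => lambda (M w) k) @^-1` `]-oo, c[ =
  \bigcup_(p in ok) \bigcap_(ij in [set: 'I_d * 'I_d])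
    (fun w => M w ij.1 ij.2) @^-1`
      `[r p.1 ij.1 ij.2 - ratr p.2, r p.1 ij.1 ij.2 + ratr p.2].
  apply/seteqP; split=> w /=.
    rewrite in_itv /= => lc.
    (* The term d q is spent twice, once from M to N and once in [ok], hence the division by 2. *)
    pose e := (c - lambda (M w) k) / (d%:R + 1) / 2.
    have d1 : 0 < d%:R + 1 :> R by rewrite ltr_wpDl.
    have e0 : 0 < e by rewrite /e !divr_gt0// subr_gt0.
    have [q] := rat_in_itvoo e0; rewrite in_itv /= => /andP[q0 qe].
    have N0 i j : exists a : rat, `|M w i j - ratr a| <= ratr q.
      have [|a] := @rat_in_itvoo _ (M w i j - ratr q) (M w i j + ratr q).
        by rewrite ltrD2l; lra.
      by rewrite in_itv /= => a_itv; exists a; rewrite ler_norml; lra.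
    have [f fP] := choice (fun ij : 'I_d * 'I_d => N0 ij.1 ij.2).
    (* Reading the approximations from the upper triangle only makes N symmetric. *)
    pose N : 'M[rat]_d := \matrix_(i, j) f (if (i <= j)%N then (i, j) else (j, i)).
    have NT : N^T = N.
      apply/matrixP => i j; rewrite !mxE.
      by case: ltngtP => // /val_inj ->.
    have NM i j : `|M w i j - r N i j| <= ratr q.
      rewrite !mxE; case: ifP => _; first exact: (fP (i, j)).
      by rewrite -(MT w) mxE; exact: (fP (j, i)).
    exists (N, q) => /=.
      split; first by rewrite /r map_trmx NT.
      have rT : (r N)^T = r N by rewrite /r map_trmx NT.
      have := @lambda_lipschitz _ (r N) (M w) (ratr q) k rT (MT w).
      move=> /(_ (fun i j => eq_ind _ (fun x => x <= _) (NM i j) _ (distrC _ _))) H.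
      have : (d%:R + 1) * ratr q < (c - lambda (M w) k) / 2.
        by rewrite mulrC -ltr_pdivlMr// mulrAC.
      by move: H; rewrite mulrDl mul1r; lra.
    by move=> [i j] _ /=; have := NM i j; rewrite in_itv/= ler_norml; lra.
  move=> [[N q] [/= NT lc] H]; rewrite in_itv /=.
  apply: le_lt_trans lc; apply: lambda_lipschitz => // i j.
  by have := H (i, j) I; rewrite /= in_itv /= ler_norml; lra.
rewrite bigcup_mkcond; apply: countable_bigcupT_measurable => [|p].
  exact: countableP.
case: ifP => _ //; apply: fin_bigcap_measurable => // -[i j] _.
by rewrite -[X in measurable X]setTI; apply: mM => //; exact: measurable_itv.
Qed.

End MeasurableLambda.

(** * Independence and concentration *)

Section IntegralMulFactor.
Local Open Scope ereal_scope.
Context {dT} {T : measurableType dT} {R : realType}.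
Variable P : {measure set T -> \bar R}.
Import HBNNSimple.

(** The factorization assumed for indicators of events of f extends to simple functions of f by
    linearity, and to f itself by monotone convergence. *)
Lemma integral_mul_factor (G f : T -> R) :
  measurable_fun setT G -> measurable_fun setT f ->
  (forall w, 0 <= G w)%R -> (forall w, 0 <= f w)%R ->
  \int[P]_w (G w)%:E \is a fin_num ->
  (forall B : set R, measurable B ->
    \int[P]_w (G w * \1_(f @^-1` B) w)%:E = \int[P]_w (G w)%:E * P (f @^-1` B)) ->
  \int[P]_w (G w * f w)%:E = \int[P]_w (G w)%:E * \int[P]_w (f w)%:E.
Proof.
move=> mG mf G0 f0 Gfin Gf; set c := \int[P]_w (G w)%:E in Gfin Gf *.
have mabs : measurable_fun [set: R] (fun y : R => (`|y| : R)%R%:E).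
  by apply/measurable_EFinP; exact: normr_measurable.
(* Simple functions are taken on the real line and composed with f, so that their level sets are
   preimages under f, as the hypothesis requires. They approximate the absolute value, which agrees
   with the identity on the values of f. *)
pose phi := nnsfun_approx measurableT mabs.
have phi_cvg y : EFin \o phi ^~ y @ \oo --> `|y|%:E.
  by apply: (cvg_nnsfun_approx measurableT mabs) => // x _; rewrite lee_fin.
have phi_nd y : {homo (fun n => phi n y) : n m / (n <= m)%N >-> (n <= m)%R}.
  by move=> n m nm; exact/lefP/nd_nnsfun_approx.
have mphi n : measurable_fun setT (fun w => phi n (f w)).
  by apply: measurableT_comp.
pose B n r := f @^-1` (phi n @^-1` [set r]).
have mB n r : measurable (B n r) by rewrite -[X in measurable X]setTI; exact: mf.
pose s n := finmap.enum_fset (fset_set (range (phi n))).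
have phiE n w : phi n (f w) = (\sum_(r <- s n) `|r| * \1_(B n r) w)%R.
  rewrite {1}[phi n (f w)]fimfunE fsbig_finite//=; apply: eq_bigr => r _.
  rewrite !indicE (_ : (f w \in _) = (w \in B n r)); last first.
    by apply/idP/idP => /set_mem ?; exact: mem_set.
  case: (boolP (w \in B n r)) => [/set_mem <-|_]; last by rewrite !mulr0.
  by rewrite ger0_norm.
have term0 n r w : 0 <= (`|r| * \1_(B n r) w)%:E.
  by rewrite lee_fin mulr_ge0.
have mterm n r : measurable_fun setT (fun w => (`|r| * \1_(B n r) w)%:E).
  by apply/measurable_EFinP/measurable_funM.
have key n : \int[P]_w (G w * phi n (f w))%:E = c * \int[P]_w (phi n (f w))%:E.
  transitivity (\sum_(r <- s n) \int[P]_w (G w * (`|r| * \1_(B n r) w))%:E).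
    rewrite -ge0_integral_sum//.
    - apply: eq_integral => w _; rewrite phiE mulr_sumr -sumEFin.
      by apply: eq_bigr.
    - move=> r; apply/measurable_EFinP/measurable_funM => //.
      exact: measurable_funM.
    - by move=> r w _; rewrite lee_fin !mulr_ge0.
  transitivity (\sum_(r <- s n) c * \int[P]_w (`|r| * \1_(B n r) w)%:E).
    apply: eq_bigr => r _.
    under eq_integral do rewrite mulrCA EFinM.
    rewrite ge0_integralZl_EFin//; last first.
    - by apply/measurable_EFinP/measurable_funM.
    - by move=> w _; rewrite lee_fin mulr_ge0.
    rewrite Gf//; under [in RHS]eq_integral do rewrite EFinM.
    rewrite ge0_integralZl_EFin//; last exact/measurable_EFinP.
    by rewrite integral_indic// setIT muleCA.
  rewrite -ge0_sume_distrr; last by move=> r _; exact: integral_ge0.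
  rewrite -ge0_integral_sum//; congr (_ * _); apply: eq_integral => w _.
  by rewrite phiE -sumEFin.
have -> : \int[P]_w (f w)%:E = limn (fun n => \int[P]_w (phi n (f w))%:E).
  rewrite -monotone_convergence//.
  - apply: eq_integral => w _; apply/esym/cvg_lim => //.
    by rewrite -{2}(ger0_norm (f0 w)); exact: phi_cvg.
  - by move=> n; exact/measurable_EFinP.
  - by move=> n w _; rewrite lee_fin.
  - by move=> w _ n m nm; rewrite lee_fin phi_nd.
have -> : \int[P]_w (G w * f w)%:E =
    limn (fun n => \int[P]_w (G w * phi n (f w))%:E).
  rewrite -monotone_convergence//.
  - apply: eq_integral => w _; apply/esym/cvg_lim => //.
    rewrite -{2}(ger0_norm (f0 w)) EFinM.
    exact: (cvgeZl (isT : (G w)%:E \is a fin_num) (phi_cvg (f w))).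
  - by move=> n; apply/measurable_EFinP/measurable_funM.
  - by move=> n w _; rewrite lee_fin mulr_ge0.
  - by move=> w _ n m nm; rewrite lee_fin ler_wpM2l// phi_nd.
under eq_fun do rewrite key.
apply/cvg_lim => //; apply: cvgeZl => //.
apply: ereal_nondecreasing_is_cvgn => n m nm.
apply: ge0_le_integral => //.
- by move=> w _; rewrite lee_fin.
- exact/measurable_EFinP.
- exact/measurable_EFinP.
- by move=> w _; rewrite lee_fin phi_nd.
Qed.

End IntegralMulFactor.

Lemma expn_le_ffact n k : (k <= n)%N -> ((n - k) ^ k <= n ^_ k)%N.
Proof.
elim: k n => [|k IH] [|n]//; rewrite ltnS subSS => kn.
by rewrite ffactnS /= expnS leq_mul ?IH// leqW// leq_subr.
Qed.

(** k^k is at most the falling factorial 2k (2k - 1) ... (k + 1), which is k! times a central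
    binomial coefficient, itself at most (1 + 1)^(2k). *)
Lemma expnn_le_fact k : (k ^ k <= 4 ^ k * k`!)%N.
Proof.
have := expn_le_ffact (leq_addr k k); rewrite addnK => /leq_trans; apply.
rewrite -bin_ffact leq_mul2r; apply/orP; right.
have -> : (4 ^ k = (1 + 1) ^ (k + k))%N by rewrite [(k + k)%N]addnn -mul2n expnM.
have kk : (k < (k + k).+1)%N by rewrite ltnS leq_addr.
rewrite expnDn (bigD1 (Ordinal kk))//= !exp1n !muln1.
exact: leq_addr.
Qed.

Section Concentration.
Local Open Scope ereal_scope.
Context {dT} {T : measurableType dT} {R : realType}.
Variable P : probability T R.

Lemma integral_prod_independent n (f : 'I_n -> T -> R) :
  (forall i, measurable_fun setT (f i)) -> (forall i w, 0 <= f i w)%R ->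
  (forall i, \int[P]_w (f i w)%:E \is a fin_num) ->
  (forall B : 'I_n -> set R, (forall i, measurable (B i)) ->
    P [set w | forall i, B i (f i w)] = \prod_i P (f i @^-1` B i)) ->
  \int[P]_w (\prod_i f i w)%:E = \prod_i \int[P]_w (f i w)%:E.
Proof.
move=> mf f0 ffin indep.
(* The indicators are replaced by the f i one index at a time. *)
pose F (s : seq 'I_n) (B : 'I_n -> set R) i w : R :=
  if i \in s then f i w else \1_(f i @^-1` B i) w.
pose E (s : seq 'I_n) (B : 'I_n -> set R) i : \bar R :=
  if i \in s then \int[P]_w (f i w)%:E else P (f i @^-1` B i).
have mfB (B : 'I_n -> set R) i : measurable (B i) -> measurable (f i @^-1` B i).
  by move=> mB; rewrite -[X in measurable X]setTI; exact: mf.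
suff main s : uniq s -> forall B, (forall i, measurable (B i)) ->
    \int[P]_w (\prod_i F s B i w)%:E = \prod_i E s B i.
  have := main (enum 'I_n) (enum_uniq _) (fun _ => setT) (fun _ => measurableT).
  rewrite /F /E; under eq_integral do under eq_bigr do rewrite mem_enum.
  by under eq_bigr do rewrite mem_enum.
elim: s => [_ B mB|k s IH /= /andP[ks us] B mB].
  rewrite -indep// -[X in P X]setIT -integral_indic//; last first.
    rewrite (_ : [set w | _] = \bigcap_(i in [set: 'I_n]) (f i @^-1` B i)).
      by apply: fin_bigcap_measurable => // i _; exact: mfB.
    by apply/seteqP; split => w /= H i; [move=> _|]; exact: H.
  apply: eq_integral => w _; congr _%:E; rewrite indicE.
  case: (boolP (w \in _)) => [/set_mem /= wB|/negP wB].
    by rewrite big1// => i _; rewrite /F /= indicE mem_set.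
  have [i wi] : exists i, ~ B i (f i w).
    by apply/existsNP => H; apply: wB; rewrite inE.
  by rewrite (bigD1 i)//= /F /= indicE memNset ?mul0r.
pose G w := (\prod_(i | i != k) F s B i w)%R.
(* The induction hypothesis, with A in place of [B k], separates an arbitrary event of [f k] from
   the other factors. This is the assumption of [integral_mul_factor]. *)
have upd (A : set R) (mA : measurable A) :
    \int[P]_w (G w * \1_(f k @^-1` A) w)%:E =
    P (f k @^-1` A) * \prod_(i | i != k) E s B i.
  pose BA i := if i == k then A else B i.
  have mBA i : measurable (BA i) by rewrite /BA; case: ifP.
  have := IH us BA mBA; rewrite [in RHS](bigD1 k)//= => H.
  rewrite [X in _ = X * _](_ : _ = E s BA k); last first.
    by rewrite /E (negbTE ks) /BA eqxx.
  rewrite [X in _ = _ * X](_ : _ = \prod_(i | i != k) E s BA i); last first.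
    by apply: eq_bigr => i ik; rewrite /E /BA (negbTE ik).
  rewrite -H; apply: eq_integral => w _; congr _%:E.
  rewrite (bigD1 k)//= mulrC /F (negbTE ks) /BA eqxx; congr (_ * _)%R.
  by apply: eq_bigr => i ik; rewrite /F (negbTE ik).
have GE : \int[P]_w (G w)%:E = \prod_(i | i != k) E s B i.
  have := upd setT measurableT.
  rewrite preimage_setT probability_setT mul1e => <-.
  by apply: eq_integral => w _; rewrite indicT mulr1.
have EGfin : \int[P]_w (G w)%:E \is a fin_num.
  rewrite GE prode_fin_num// => i _; rewrite /E; case: ifP => // _.
  by rewrite fin_num_measure//; exact: mfB.
have mF i : measurable_fun setT (F s B i).
  by rewrite /F; case: (i \in s) => //; exact/measurable_indicP/mfB.
have mG : measurable_fun setT G.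
  rewrite /G; under eq_fun do rewrite big_mkcond.
  by apply: measurable_prod => i _; case: (i != k).
have G0 w : (0 <= G w)%R.
  by apply: prodr_ge0 => i _; rewrite /F; case: ifP.
transitivity (\int[P]_w (G w * f k w)%:E).
  apply: eq_integral => w _; congr _%:E.
  rewrite (bigD1 k)//= mulrC /F mem_head; congr (_ * _)%R.
  by apply: eq_bigr => i ik; rewrite inE (negbTE ik).
rewrite integral_mul_factor//; last first.
  by move=> A mA; rewrite upd// muleC GE.
rewrite GE [RHS](bigD1 k)//= muleC {2}/E mem_head; congr (_ * _).
by apply: eq_bigr => i ik; rewrite /E inE (negbTE ik).
Qed.

(** For Y nonnegative the partial sums of the exponential series increase, so monotone convergence
    carries a uniform bound to the limit. *)
Lemma integral_expR_le (Y : T -> R) (b : R) :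
  measurable_fun setT Y -> (forall w, 0 <= Y w)%R ->
  (forall n, \sum_(k < n) \int[P]_w (Y w ^+ k / k`!%:R)%:E <= b%:E) ->
  \int[P]_w (expR (Y w))%:E <= b%:E.
Proof.
move=> mY Y0 Yb; pose S n w : R := (\sum_(k < n) (Y w ^+ k / k`!%:R))%R.
have t0 k w : (0 <= Y w ^+ k / k`!%:R)%R by rewrite divr_ge0// exprn_ge0.
have mt k : measurable_fun setT (fun w => Y w ^+ k / k`!%:R)%R.
  by apply: measurable_funM => //; exact: measurable_funX.
have mS n : measurable_fun setT (S n) by exact: measurable_sum.
have S0 n w : (0 <= S n w)%R by exact: sumr_ge0.
have SE w : (expR (Y w))%:E = limn (fun n => (S n w)%:E).
  rewrite -(EFin_lim (is_cvg_series_exp_coeff (Y w))); congr (limn _).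
  by apply/funext => n /=; rewrite /series/= big_mkord.
have Snd w n m : (n <= m)%N -> (S n w)%:E <= (S m w)%:E.
  move=> nm; rewrite lee_fin /S -!(big_mkord xpredT (fun k => Y w ^+ k / k`!%:R)%R).
  by rewrite (@big_cat_nat _ _ _ n 0%N m)//= lerDl sumr_ge0.
under eq_integral do rewrite SE.
rewrite monotone_convergence//; first last.
- by move=> w _ n m; exact: Snd.
- by move=> n w _; rewrite lee_fin.
- by move=> n; exact/measurable_EFinP.
apply: lime_le.
  apply: ereal_nondecreasing_is_cvgn => n m nm.
  by apply: ge0_le_integral => //; [move=> w _; rewrite lee_fin|
    exact/measurable_EFinP|exact/measurable_EFinP|move=> w _; exact: Snd].
apply: nearW => n; apply: le_trans (Yb n).
under eq_integral do rewrite -sumEFin.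
rewrite ge0_integral_sum//.
  by move=> k; exact/measurable_EFinP.
by move=> k w _; rewrite lee_fin.
Qed.

(** The first-order term is kept exactly, as l m with l = a / K^2, so that the centering cancels it.
    The later terms form a geometric series of ratio 8 a <= 1/2 with sum at most 2 (8 a)^2 = 128
    a^2, and 1 + x <= exp x concludes. *)
Lemma mgf_square_le (W : T -> R) (K m a : R) :
  measurable_fun setT W -> (0 < K)%R -> (0 <= a <= 16^-1)%R ->
  \int[P]_w (W w ^+ 2)%:E = m%:E ->
  (forall k, (0 < k)%N ->
    \int[P]_w (W w ^+ (2 * k))%:E <= ((2 * k%:R * K ^+ 2) ^+ k)%:E) ->
  \int[P]_w (expR (a / K ^+ 2 * (W w ^+ 2 - m)))%:E <= (expR (128 * a ^+ 2))%:E.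
Proof.
move=> mW K0 /andP[a0 a1] Wm Wk; set l := (a / K ^+ 2)%R.
have l0 : (0 <= l)%R by rewrite divr_ge0// sqr_ge0.
have lK : (l * K ^+ 2 = a)%R by rewrite /l divfK// expf_neq0// gt_eqF.
clearbody l.
have m0 : (0 <= m)%R.
  by rewrite -lee_fin -Wm integral_ge0// => w _; rewrite lee_fin sqr_ge0.
have mW2 : measurable_fun setT (fun w => W w ^+ 2)%R by exact: measurable_funX.
(* k^k <= 4^k k! turns the k-th term of the exponential series into (8 a)^k. *)
pose c k : R := (if k is k'.+1 then if k' is 0 then l * m else (8 * a) ^+ k else 1)%R.
have term k : \int[P]_w ((l * W w ^+ 2) ^+ k / k`!%:R)%:E <= (c k)%:E.
  have -> : \int[P]_w ((l * W w ^+ 2) ^+ k / k`!%:R)%:E =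
      (l ^+ k / k`!%:R)%:E * \int[P]_w (W w ^+ (2 * k))%:E.
    rewrite -ge0_integralZl_EFin//; last 3 first.
    - by move=> w _; rewrite lee_fin exprM exprn_ge0// sqr_ge0.
    - exact/measurable_EFinP/measurable_funX.
    - by rewrite divr_ge0// exprn_ge0.
    apply: eq_integral => w _; rewrite -EFinM; congr _%:E.
    by rewrite exprMn exprM mulrAC.
  case: k => [|[|k]].
  - rewrite muln0 fact0 expr0 divr1 mul1e; under eq_integral do rewrite expr0.
    by rewrite integral_cst// mul1e; exact: probability_le1.
  - by rewrite muln1 factS fact0 mul1n divr1 expr1 Wm.
  rewrite /c; set n := k.+2.
  apply: (le_trans (lee_wpmul2l _ (Wk n isT))).
    by rewrite lee_fin divr_ge0// exprn_ge0.
  rewrite -EFinM lee_fin.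
  have -> : (l ^+ n / n`!%:R * (2 * n%:R * K ^+ 2) ^+ n =
      (2 * a) ^+ n * ((n ^ n)%:R / n`!%:R))%R.
    rewrite -lK natrX !exprMn.
    move: (_^-1)%R (l ^+ n)%R ((K ^+ 2) ^+ n)%R (2 ^+ n)%R (n%:R ^+ n)%R.
    by move=> *; ring.
  have -> : ((8 * a) ^+ n = (2 * a) ^+ n * (4 ^ n)%:R)%R.
    by rewrite natrX -exprMn; congr (_ ^+ _)%R; ring.
  rewrite ler_wpM2l ?exprn_ge0 ?mulr_ge0// ler_pdivrMr ?ltr0n ?fact_gt0//.
  by rewrite -natrM ler_nat expnn_le_fact.
have sum_c n : (\sum_(k < n) c k <= 1 + l * m + 128 * a ^+ 2)%R.
  have lm0 : (0 <= l * m)%R by exact: mulr_ge0.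
  have a2 : (0 <= 128 * a ^+ 2)%R by rewrite mulr_ge0// sqr_ge0.
  case: n => [|[|n]]; first by rewrite big_ord0; lra.
    by rewrite big_ord_recl big_ord0 /=; lra.
  rewrite !big_ord_recl /= addrA lerD2l.
  rewrite (eq_bigr (fun i : 'I_n => (8 * a) ^+ 2 * (8 * a) ^+ i)%R); last first.
    by move=> i _; rewrite -exprD.
  rewrite -mulr_sumr.
  have : (\sum_(i < n) (8 * a) ^+ i <= 2)%R.
    by apply: sum_geometric_le2; apply/andP; split; lra.
  have : (0 <= (8 * a) ^+ 2)%R by exact: sqr_ge0.
  move: (\sum_(i < n) _)%R => s; rewrite exprMn; nra.
have E := @integral_expR_le (fun w => l * W w ^+ 2)%R
  (1 + l * m + 128 * a ^+ 2)%R.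
have {}E : \int[P]_w (expR (l * W w ^+ 2))%:E <= (1 + l * m + 128 * a ^+ 2)%:E.
  apply: E => //.
  - exact: measurable_funM.
  - by move=> w; rewrite mulr_ge0// sqr_ge0.
  - move=> n; apply: (@le_trans _ _ (\sum_(k < n) (c k)%:E)).
      by apply: lee_sum => k _; exact: term.
    by rewrite sumEFin lee_fin.
under eq_integral do rewrite mulrBr expRB mulrC EFinM.
rewrite ge0_integralZl_EFin//; last first.
  apply/measurable_EFinP; apply: measurableT_comp => //.
  exact: measurable_funM.
apply: (le_trans (lee_wpmul2l _ E)); first by rewrite lee_fin invr_ge0 expR_ge0.
rewrite -EFinM lee_fin mulrC ler_pdivrMr ?expR_gt0// -expRD.
by apply: le_trans (expR_ge1Dx _); lra.
Qed.

Lemma mgf_square_neg_le (W : T -> R) (K m a : R) :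
  measurable_fun setT W -> (0 < K)%R -> (0 <= a <= 16^-1)%R ->
  \int[P]_w (W w ^+ 2)%:E = m%:E ->
  \int[P]_w (W w ^+ 4)%:E <= ((4 * K ^+ 2) ^+ 2)%:E ->
  \int[P]_w (expR (- (a / K ^+ 2) * (W w ^+ 2 - m)))%:E <= (expR (128 * a ^+ 2))%:E.
Proof.
move=> mW K0 /andP[a0 a1] Wm W4; set l := (a / K ^+ 2)%R.
have l0 : (0 <= l)%R by rewrite divr_ge0// sqr_ge0.
have lK : (l * K ^+ 2 = a)%R by rewrite /l divfK// expf_neq0// gt_eqF.
clearbody l.
have mW2 k : measurable_fun setT (fun w => W w ^+ k)%R by exact: measurable_funX.
have mE : measurable_fun setT (fun w => (expR (- (l * W w ^+ 2)))%:E).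
  apply/measurable_EFinP; apply: measurableT_comp => //.
  by apply: measurableT_comp => //; exact: measurable_funM.
have W20 w : (0 <= l * W w ^+ 2)%R by rewrite mulr_ge0// sqr_ge0.
have mlW k x : measurable_fun setT (fun w => (x * W w ^+ k)%:E).
  by apply/measurable_EFinP; exact: measurable_funM.
(* exp (- x) <= 1 / (1 + x) <= 1 - x + x^2, with x moved to the left so that
   both sides are nonnegative. *)
have pt w : (expR (- (l * W w ^+ 2)) + l * W w ^+ 2 <= 1 + l ^+ 2 * W w ^+ 4)%R.
  have := W20 w; rewrite (_ : (l ^+ 2 * W w ^+ 4 = (l * W w ^+ 2) ^+ 2)%R); last first.
    by rewrite exprMn -exprM.
  move: (l * _)%R => x x0; rewrite expRN.
  have x1 : (0 < 1 + x)%R by lra.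
  rewrite -lerBrDr (le_trans (y := ((1 + x)^-1)%R))//.
    by rewrite lef_pV2 ?posrE ?expR_gt0// expR_ge1Dx.
  by rewrite -div1r ler_pdivrMr//; nra.
(* The fourth moment contributes l^2 (4 K^2)^2 = 16 a^2. *)
have E : \int[P]_w (expR (- (l * W w ^+ 2)))%:E + (l * m)%:E <= (1 + 16 * a ^+ 2)%:E.
  have -> : (l * m)%:E = \int[P]_w (l * W w ^+ 2)%:E.
    under eq_integral do rewrite EFinM.
    rewrite ge0_integralZl_EFin// ?Wm//.
      by move=> w _; rewrite lee_fin sqr_ge0.
    exact/measurable_EFinP.
  rewrite -ge0_integralD//; last by move=> w _; rewrite lee_fin.
  apply: (@le_trans _ _ (\int[P]_w (1 + l ^+ 2 * W w ^+ 4)%:E)).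
    apply: ge0_le_integral => //.
    - by move=> w _; rewrite -EFinD lee_fin addr_ge0// expR_ge0.
    - exact: emeasurable_funD.
    - by apply/measurable_EFinP/measurable_funD => //; exact: measurable_funM.
    - by move=> w _; rewrite -EFinD lee_fin.
  have l20 : (0 <= l ^+ 2)%R by exact: sqr_ge0.
  have W40 w : (0 <= W w ^+ 4)%R by have := sqr_ge0 (W w ^+ 2)%R; rewrite -exprM.
  under eq_integral do rewrite EFinD.
  rewrite ge0_integralD//; last by move=> w _; rewrite lee_fin mulr_ge0.
  rewrite integral_cst// mul1e EFinD leeD//; first exact: probability_le1.
  under eq_integral do rewrite EFinM.
  rewrite ge0_integralZl_EFin//; last first.
  - exact/measurable_EFinP.
  - by move=> w _; rewrite lee_fin.
  apply: (le_trans (lee_wpmul2l _ W4)); first by rewrite lee_fin.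
  rewrite -EFinM lee_fin -lK le_eqVlt; apply/orP; left; apply/eqP; ring.
have El : \int[P]_w (expR (- (l * W w ^+ 2)))%:E <= (1 - l * m + 16 * a ^+ 2)%:E.
  by rewrite -leeBrDr// in E; apply: (le_trans E); rewrite -EFinB lee_fin; lra.
under eq_integral do rewrite mulNr mulrBr opprB addrC expRD mulrC EFinM.
rewrite ge0_integralZl_EFin//.
apply: (le_trans (lee_wpmul2l _ El)); first by rewrite lee_fin expR_ge0.
rewrite -EFinM lee_fin -ler_pdivlMl ?expR_gt0// -expRN -expRD.
apply: le_trans (expR_ge1Dx _); have := sqr_ge0 a; lra.
Qed.

(** For a unit vector, the exponent p = 2 k in the definition gives (sqrt p K)^p. A nonzero u is its
    norm, at most 1, times a unit vector. *)
Lemma psi2_norm_moment d (z : T -> 'cV[R]_d) (K : R) (u : 'cV[R]_d) k :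
  psi2_norm P z <= K%:E -> (inner u u <= 1)%R -> (0 < k)%N ->
  (forall j, measurable_fun setT (fun w => z w j 0)%R) ->
  \int[P]_w (inner (z w) u ^+ (2 * k))%:E <= ((2 * k%:R * K ^+ 2) ^+ k)%:E.
Proof.
move=> zK u1 k0 mz.
have b0 : (0 <= (2 * k%:R * K ^+ 2) ^+ k)%R.
  by rewrite exprn_ge0// mulr_ge0 ?sqr_ge0// mulr_ge0.
have minner (v : 'cV[R]_d) : measurable_fun setT (fun w => inner (z w) v).
  by apply: measurable_sum => j; exact: measurable_funM.
have even0 x : (0 <= x ^+ (2 * k) :> R)%R by rewrite exprM exprn_ge0// sqr_ge0.
have unit_case v : norm2 v = 1%R ->
    \int[P]_w (inner (z w) v ^+ (2 * k))%:E <= ((2 * k%:R * K ^+ 2) ^+ k)%:E.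
  move=> v1; pose p : R := (2 * k)%:R.
  have p1 : (1 <= p)%R by rewrite ler1n muln_gt0.
  have p0 : (0 < p)%R by exact: lt_le_trans p1.
  have sp0 : (0 < Num.sqrt p)%R by rewrite sqrtr_gt0.
  pose N := 'N[P]_p%:E[(fun w => (inner (z w) v)%:E)].
  have : (Num.sqrt p)^-1%:E * N <= K%:E.
    by apply: le_trans zK; apply: ereal_sup_ubound; exists v, p.
  rewrite lee_pdivrMl// -EFinM => NK.
  have K0 : (0 <= Num.sqrt p * K)%R.
    by rewrite -lee_fin; apply: le_trans NK; exact: Lnorm_ge0.
  have -> : \int[P]_w (inner (z w) v ^+ (2 * k))%:E = N `^ p.
    rewrite poweR_Lnorm ?gt_eqF//; apply: eq_integral => w _.
    rewrite abse_EFin poweR_EFin powR_mulrn//.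
    by rewrite -normrX ger0_norm.
  apply: (@le_trans _ _ ((Num.sqrt p * K)%:E `^ p)).
    apply: gt0_ler_poweR; rewrite ?in_itv /= ?leey ?andbT ?lee_fin ?Lnorm_ge0//.
  rewrite poweR_EFin lee_fin powR_mulrn// exprM (exprMn 2) sqr_sqrtr ?(ltW p0)//.
  by rewrite /p natrM.
have [->|u0] := eqVneq u 0%R.
  rewrite (eq_integral (cst 0)) ?integral0//.
  move=> w _; rewrite /inner big1; first by rewrite expr0n muln_eq0 /= eqn0Ngt k0.
  by move=> j _; rewrite mxE mulr0.
have iu0 : (0 < inner u u)%R by exact: inner_gt0.
have nu0 : (0 < norm2 u)%R by rewrite sqrtr_gt0.
have nu1 : (norm2 u ^+ (2 * k) <= 1)%R.
  by rewrite exprn_ile1 ?sqrtr_ge0// -sqrtr1 ler_wsqrtr.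
pose v := ((norm2 u)^-1 *: u)%R.
have v1 : norm2 v = 1%R.
  rewrite /norm2 /v innerZl innerZr mulrA -expr2 sqrtrM ?sqr_ge0//.
  by rewrite sqrtr_sqr ger0_norm ?invr_ge0 ?ltW// mulVf// gt_eqF.
have uE : u = (norm2 u *: v)%R by rewrite /v scalerA mulfV ?scale1r// gt_eqF.
rewrite (eq_integral (fun w => (norm2 u ^+ (2 * k))%:E *
    (inner (z w) v ^+ (2 * k))%:E)); last first.
  by move=> w _; rewrite {1}uE innerZr exprMn.
rewrite ge0_integralZl_EFin ?exprn_ge0 ?sqrtr_ge0//; last first.
  exact/measurable_EFinP/measurable_funX.
  by move=> w _; rewrite lee_fin.
apply: (le_trans (lee_wpmul2l _ (unit_case v v1))).
  by rewrite lee_fin exprn_ge0// sqrtr_ge0.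
by rewrite -EFinM lee_fin ler_piMl.
Qed.

Lemma measurable_superlevel (f : T -> R) (s : R) :
  measurable_fun setT f -> measurable [set w | (s <= f w)%R].
Proof.
move=> mf; rewrite (_ : [set w | _] = f @^-1` `[s, +oo[).
  by rewrite -[X in measurable X]setTI; exact: mf measurableT _ (measurable_itv _).
by apply/seteqP; split => w /=; rewrite in_itv /= andbT.
Qed.

(** Markov's inequality for the exponential of the sum, whose expectation splits into a product by
    independence. *)
Lemma chernoff_independent n (f : 'I_n -> T -> R) (c s : R) :
  (forall i, measurable_fun setT (f i)) ->
  (forall B : 'I_n -> set R, (forall i, measurable (B i)) ->
    P [set w | forall i, B i (f i w)] = \prod_i P (f i @^-1` B i)) ->
  (forall i, \int[P]_w (expR (f i w))%:E <= (expR c)%:E) ->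
  P [set w | (s <= \sum_i f i w)%R] <= (expR (n%:R * c - s))%:E.
Proof.
move=> mf indep fc; set A := [set w | _].
have mS : measurable_fun setT (fun w => \sum_i f i w)%R by exact: measurable_sum.
have mA : measurable A by exact: measurable_superlevel.
have mef i : measurable_fun setT (fun w => expR (f i w)).
  by apply: measurableT_comp.
have ef0 i : 0 <= \int[P]_w (expR (f i w))%:E.
  by apply: integral_ge0 => w _; rewrite lee_fin expR_ge0.
rewrite expRB EFinM lee_pdivlMr ?expR_gt0//.
apply: (@le_trans _ _ (\int[P]_w (expR (\sum_i f i w))%:E)).
  rewrite muleC -[A]setIT -integral_indic// -ge0_integralZl_EFin ?expR_ge0//; last first.
    exact/measurable_EFinP.
  apply: ge0_le_integral => //.
  - by apply/measurable_EFinP/measurable_funM.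
  - by apply/measurable_EFinP; exact: measurableT_comp.
  - move=> w _; rewrite -EFinM lee_fin indicE.
    case: (boolP (w \in A)) => [/set_mem wA|_]; last by rewrite mulr0 expR_ge0.
    by rewrite mulr1 ler_expR.
under eq_integral do rewrite expR_sum.
have ffin i : \int[P]_w (expR (f i w))%:E \is a fin_num.
  by rewrite ge0_fin_numE//; apply: le_lt_trans (fc i) _; rewrite ltry.
rewrite (integral_prod_independent (f := fun i w => expR (f i w)))//.
- rewrite (eq_bigr (fun i => (fine (\int[P]_w (expR (f i w))%:E))%:E)); last first.
    by move=> i _; rewrite fineK.
  rewrite prodEFin lee_fin expRM_natl.
  have -> : (expR c ^+ n = \prod_(i < n) expR c)%R by rewrite prodr_const card_ord.
  apply: ler_prod => i _; apply/andP; split; first exact: fine_ge0.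
  by rewrite -lee_fin fineK.
- move=> B mB; rewrite -(indep (fun i => expR @^-1` B i))// => i.
  by rewrite -[X in measurable X]setTI; apply: measurable_expR.
Qed.

(** [B] is the union of the two tails, bounded by the Chernoff method with multipliers a / K^2 and -
    a / K^2. The parameter a is left free, to be chosen according to r. *)
Lemma bernstein_squares n (W : 'I_n -> T -> R) (K a r : R) (m : 'I_n -> R) :
  (0 < K)%R -> (0 < a <= 16^-1)%R ->
  (forall i, measurable_fun setT (W i)) ->
  (forall i, \int[P]_w (W i w ^+ 2)%:E = (m i)%:E) ->
  (forall i k, (0 < k)%N ->
    \int[P]_w (W i w ^+ (2 * k))%:E <= ((2 * k%:R * K ^+ 2) ^+ k)%:E) ->
  (forall B : 'I_n -> set R, (forall i, measurable (B i)) ->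
    P [set w | forall i, B i (W i w)] = \prod_i P (W i @^-1` B i)) ->
  exists B : set T, [/\ measurable B,
    P B <= (2 * expR (n%:R * (128 * a ^+ 2 - a * r)))%:E &
    forall w, ~ B w -> (`|\sum_i (W i w ^+ 2 - m i)| <= n%:R * K ^+ 2 * r)%R].
Proof.
move=> K0 /andP[a0 a1] mW Wm Wk indep.
have a01 : (0 <= a <= 16^-1)%R by rewrite ltW.
pose l := (a / K ^+ 2)%R; pose s := (n%:R * (a * r))%R.
have l0 : (0 < l)%R by rewrite divr_gt0// exprn_gt0.
have lK : (l * K ^+ 2 = a)%R by rewrite /l divfK// expf_neq0// gt_eqF.
pose g (c : R) i w := (c * (W i w ^+ 2 - m i))%R.
have mg c i : measurable_fun setT (g c i).
  apply: measurable_funM => //; apply: measurable_funB => //.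
  exact: measurable_funX.
have gindep c (B : 'I_n -> set R) : (forall i, measurable (B i)) ->
    P [set w | forall i, B i (g c i w)] = \prod_i P (g c i @^-1` B i).
  move=> mB; pose h i (x : R) := (c * (x ^+ 2 - m i))%R.
  rewrite -(indep (fun i => h i @^-1` B i))// => i.
  rewrite -[X in measurable X]setTI.
  have mh : measurable_fun setT (h i).
    by apply: measurable_funM => //; apply: measurable_funB.
  exact: mh.
pose A c : set T := [set w | (s <= \sum_i g c i w)%R].
have mA c : measurable (A c).
  by apply: measurable_superlevel; exact: measurable_sum.
have PA c : (forall i, \int[P]_w (expR (g c i w))%:E <= (expR (128 * a ^+ 2))%:E) ->
    P (A c) <= (expR (n%:R * (128 * a ^+ 2 - a * r)))%:E.
  move=> gc; rewrite [X in expR X]mulrBr.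
  exact: (chernoff_independent s (mg c) (@gindep c) gc).
exists (A l `|` A (- l)%R); split; first exact: measurableU.
  apply: (le_trans (measureU2 _ _ _)) => //.
  rewrite mulrDl mul1r EFinD leeD// PA// => i.
    exact: (mgf_square_le (mW i) K0 a01 (Wm i) (Wk i)).
  apply: (mgf_square_neg_le (mW i) K0 a01 (Wm i)).
  apply: le_trans (Wk i 2%N isT) _.
  by rewrite lee_fin -natrM.
move=> w /not_orP[/negP + /negP]; rewrite -!ltNge -!mulr_sumr mulNr.
set S := (\sum_i _)%R => S1 S2.
have sE : s = (l * (n%:R * K ^+ 2 * r))%R by rewrite /s -lK; ring.
rewrite sE ltr_pM2l// in S1; rewrite sE -mulrN ltr_pM2l// in S2.
by rewrite ler_norml; apply/andP; split; lra.
Qed.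

(** The constant is 960 = 3 * 320: deviation 320 at the net points makes the tail beat the size of
    the net, and [quadratic_net] loses a factor 3. *)
Lemma quadratic_concentration n d (z : 'I_n -> T -> 'cV[R]_d) (K t : R) :
  (0 < d)%N -> (0 < n)%N -> (0 <= K)%R -> (0 <= t)%R ->
  (forall i j, measurable_fun setT (fun w => z i w j 0)%R) ->
  (forall i, psi2_norm P (z i) <= K%:E) ->
  (forall u, \sum_i \int[P]_w (inner (z i w) u ^+ 2)%:E = (n%:R * inner u u)%:E) ->
  (forall u (B : 'I_n -> set R), (forall i, measurable (B i)) ->
    P [set w | forall i, B i (inner (z i w) u)] =
    \prod_i P ((fun w => inner (z i w) u) @^-1` B i)) ->
  let eps := (Num.sqrt (d%:R / n%:R) + t / Num.sqrt n%:R)%R in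
  exists G : set T, [/\ measurable G,
    (1 - 2 * expR (- t ^+ 2))%:E <= P G &
    forall w, G w -> forall u,
      (`|n%:R^-1 * \sum_i inner (z i w) u ^+ 2 - inner u u| <=
        960 * K ^+ 2 * Num.max eps (eps ^+ 2) * inner u u)%R].
Proof.
move=> d0 n0 K0 t0 mz zK iso indep eps.
set del := Num.max eps (eps ^+ 2)%R.
have nR : (0 < n%:R :> R)%R by rewrite ltr0n.
have dR : (0 < d%:R :> R)%R by rewrite ltr0n.
have sn : (0 < Num.sqrt n%:R :> R)%R by rewrite sqrtr_gt0.
have eps0 : (0 < eps)%R.
  by apply: ltr_wpDr; [rewrite divr_ge0// ltW|rewrite sqrtr_gt0 divr_gt0].
(* The Chernoff parameter eta / 16 has to stay below 1 / 16. The truncation at 1 is compensated by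
   the maximum in [del], as eta del = eps^2 in both regimes. *)
pose eta := Num.min eps 1%R.
have eta0 : (0 < eta)%R by rewrite lt_min eps0 ltr01.
have eta_eps : (eta <= eps)%R by rewrite ge_min lexx.
have eta1 : (eta <= 1)%R by rewrite ge_min lexx orbT.
have eta_del : (eta * del = eps ^+ 2)%R.
  rewrite /eta /del; have [e1|e1] := leP eps 1%R.
    by rewrite max_l ?expr2 // ler_piMl// ltW.
  by rewrite max_r ?mul1r// expr2 ler_peMl// ltW.
(* n eps^2 is the square of sqrt d + t. *)
have neps : (d%:R + t ^+ 2 <= n%:R * eps ^+ 2)%R.
  have -> : (n%:R * eps ^+ 2 = (Num.sqrt d%:R + t) ^+ 2)%R.
    rewrite -{1}(sqr_sqrtr (ltW nR)) -exprMn /eps sqrtrM ?ltW// sqrtrV ?ltW//.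
    by congr (_ ^+ 2)%R; field; rewrite gt_eqF.
  rewrite sqrrD sqr_sqrtr ?(ltW dR)// addrAC lerDl mulrn_wge0//.
  by rewrite mulr_ge0// sqrtr_ge0.
have minner i u : measurable_fun setT (fun w => inner (z i w) u).
  by apply: measurable_sum => j; exact: measurable_funM.
pose m u i := fine (\int[P]_w (inner (z i w) u ^+ 2)%:E).
have mom u i k : (inner u u <= 1)%R -> (0 < k)%N ->
    \int[P]_w (inner (z i w) u ^+ (2 * k))%:E <= ((2 * k%:R * K ^+ 2) ^+ k)%:E.
  by move=> *; exact: psi2_norm_moment.
have mE u i : (inner u u <= 1)%R ->
    \int[P]_w (inner (z i w) u ^+ 2)%:E = (m u i)%:E.
  move=> u1; rewrite /m fineK// ge0_fin_numE.
    by apply: le_lt_trans (mom u i 1%N u1 isT) _; rewrite ltry.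
  by apply: integral_ge0 => w _; rewrite lee_fin sqr_ge0.
have summ u : (inner u u <= 1)%R -> (\sum_i m u i = n%:R * inner u u)%R.
  move=> u1; apply: EFin_inj; rewrite -iso -sumEFin.
  by apply: eq_bigr => i _; rewrite mE.
(* If K were 0, all second moments would vanish, whereas by [iso] those along a basis vector add up
   to n. *)
have Kgt0 : (0 < K)%R.
  rewrite lt_def K0 andbT; apply/eqP => KE.
  pose e : 'cV[R]_d := delta_mx (Ordinal d0) 0%R.
  have e1 : inner e e = 1%R.
    by rewrite innerE trmx_delta mul_delta_mx mxE !eqxx.
  have : (\sum_i m e i <= 0)%R.
    apply: sumr_le0 => i _; rewrite -lee_fin -mE ?e1//.
    apply: le_trans (mom e i 1%N _ isT) _; first by rewrite e1.
    by rewrite KE expr0n /= mulr0 expr1.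
  by rewrite summ e1// mulr1 leNgt nR.
have [N [Ncard N1 Nnet]] := @sphere_net R d d0.
(* The norm condition sits under the existential so that [choice] yields a bad set for every y at
   once. *)
have bad y : exists B : set T, (inner y y <= 1)%R -> [/\ measurable B,
    P B <= (2 * expR (- (19 * (d%:R + t ^+ 2))))%:E &
    forall w, ~ B w -> (`|\sum_i inner (z i w) y ^+ 2 - n%:R * inner y y| <=
       n%:R * K ^+ 2 * (320 * del))%R].
  have [y1|//] := leP (inner y y) 1%R; last by exists set0.
  (* The exponent is then n (eta^2 / 2 - 20 eta del) with eta del = eps^2 and
     eta <= eps. *)
  have a1 : (0 < eta / 16 <= 16^-1)%R.
    by rewrite divr_gt0//= ler_pdivrMr// mulVf.
  have [B [mB PB HB]] := bernstein_squares
    (W := fun i w => inner (z i w) y) (320 * del)%R Kgt0 a1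
    (fun i => minner i y) (fun i => mE y i y1) (fun i k => mom y i k y1) (indep y).
  exists B => _; split => //.
    apply: (le_trans PB); rewrite lee_fin ler_pM2l// ler_expR.
    have -> : (n%:R * (128 * (eta / 16) ^+ 2 - eta / 16 * (320 * del)) =
       n%:R * eta ^+ 2 / 2 - 20 * (n%:R * (eta * del)))%R by field.
    rewrite eta_del.
    (* The exponent is thus at most - (39 / 2) n eps^2, and [neps] bounds this by - 19 (d + t^2). *)
    have : (n%:R * eta ^+ 2 <= n%:R * eps ^+ 2)%R.
      by rewrite ler_pM2l// lerXn2r ?nnegrE ?(ltW eta0) ?(ltW eps0).
    have := sqr_ge0 t; lra.
  move=> w wB; have := HB w wB; rewrite sumrB summ//.
have [B BP] := choice bad.
pose Bad := \big[setU/set0]_(y <- N) B y.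
have mBad : measurable Bad.
  rewrite /Bad big_seq; apply: bigsetU_measurable => y yN.
  by have [] := BP y (N1 y yN).
have PBad : P Bad <= ((size N)%:R * (2 * expR (- (19 * (d%:R + t ^+ 2)))))%:E.
  rewrite /Bad; elim: (N) N1 => [|y s IH] s1.
    by rewrite big_nil measure0 mul0r.
  have [mB PB _] := BP y (s1 y (mem_head _ _)).
  have s1' x : x \in s -> (inner x x <= 1)%R.
    by move=> xs; apply: s1; rewrite inE xs orbT.
  rewrite big_cons; apply: (le_trans (measureU2 _ _ _)) => //.
    rewrite big_seq; apply: bigsetU_measurable => x xs.
    by have [] := BP x (s1' x xs).
  rewrite /= -natr1 mulrDl mul1r addrC EFinD leeD//.
  exact: IH.
exists (~` Bad); split; first exact: measurableC.
  rewrite probability_setC// EFinB leeB// (le_trans PBad)// lee_fin.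
  rewrite mulrCA ler_pM2l//.
  (* Since 2 <= e, the net has at most exp (18 d) points, and 18 d - 19 (d + t^2) <= - t^2. *)
  have N2 : ((size N)%:R <= expR (18 * d%:R) :> R)%R.
    apply: (le_trans Ncard).
    rewrite -natrM -[X in expR X]mulr1 expRM_natl lerXn2r ?nnegrE ?expR_ge0//.
    by rewrite -[leLHS]/(1 + 1)%R expR_ge1Dx.
  apply: (le_trans (ler_wpM2r (expR_ge0 _) N2)); rewrite -expRD ler_expR.
  have := sqr_ge0 t; lra.
move=> w wG u.
(* The deviation is the quadratic form of this symmetric matrix, so control at the net points
   extends to all u. *)
pose A : 'M[R]_d := (n%:R^-1 *: (\sum_i z i w *m (z i w)^T) - 1%:M)%R.
have AE v : inner v (A *m v) =
    (n%:R^-1 * \sum_i inner (z i w) v ^+ 2 - inner v v)%R.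
  have -> : (A *m v = n%:R^-1 *: (\sum_i z i w *m (z i w)^T *m v) - v)%R.
    by rewrite /A mulmxBl mul1mx -scalemxAl mulmx_suml.
  rewrite -scaleN1r innerDr !innerZr mulN1r; congr (_ * _ - _)%R.
  rewrite innerE mulmx_sumr summxE; apply: eq_bigr => i _; rewrite -innerE.
  by rewrite -mulmxA inner_mulmx {1}/inner big_ord1 -innerE expr2.
have AT : A^T = A.
  rewrite /A linearB /= trmx1 linearZ /= linear_sum /=; congr (_ *: _ - _)%R.
  by apply: eq_bigr => i _; rewrite trmx_mul trmxK.
rewrite -AE.
have := @quadratic_net R d A N (320 * K ^+ 2 * del)%R AT Nnet.
move=> /(_ _ u) H; apply: le_trans (H _) _; last first.
  by rewrite le_eqVlt; apply/orP; left; apply/eqP; ring.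
move=> y yN; rewrite AE; have [_ _ /(_ w)] := BP y (N1 y yN).
have nB : ~ B y w.
  by move=> Byw; apply: wG; rewrite /Bad -bigcup_seq; exists y.
move=> /(_ nB) Hy.
have -> : (n%:R^-1 * \sum_i inner (z i w) y ^+ 2 - inner y y =
   n%:R^-1 * (\sum_i inner (z i w) y ^+ 2 - n%:R * inner y y))%R.
  by rewrite mulrBr mulKf// gt_eqF.
rewrite normrM (ger0_norm (ltW _)) ?invr_gt0// ler_pdivrMl//.
by apply: (le_trans Hy); rewrite le_eqVlt; apply/orP; left; apply/eqP; ring.
Qed.

End Concentration.

(** * Sample covariance matrices *)

(** Coordinates are continuous, hence Borel. This passes measurability and independence from random
    vectors to their linear functionals. *)
Lemma borel_preimage_inner {R : realType} d (v : 'cV[R]_d) (B : set R) :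
  measurable B -> borel ((fun u => inner u v) @^-1` B).
Proof.
move=> mB; pose aT := g_sigma_algebraType [set U : set 'cV[R]_d | open U].
have mcoord (j : 'I_d) :
    measurable_fun (setT : set aT) (fun u : aT => (u : 'cV[R]_d) j 0).
  apply: (measurability _ (RGenInftyO.measurableE R)).
  move=> _ [_ [c ->] <-]; rewrite setTI; apply: sub_sigma_algebra.
  have /continuousP cc := @coord_continuous R d 1 j 0.
  exact: cc _ (lray_open c).
have : measurable_fun (setT : set aT) (fun u : aT => inner (u : 'cV[R]_d) v).
  by apply: measurable_sum => j; exact: measurable_funM.
by move=> /(_ measurableT _ mB); rewrite setTI.
Qed.

Lemma expect_mx_quadratic dT (T : measurableType dT) (R : realType)
    (P : probability T R) d (M : T -> 'M[R]_d) (u : 'cV[R]_d) :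
  integrable_mx P M ->
  (\int[P]_w (inner u (M w *m u))%:E = (inner u (expect_mx P M *m u))%:E)%E.
Proof.
move=> iM.
have quadE (A : 'M[R]_d) :
    inner u (A *m u) = \sum_i \sum_j u i 0 * u j 0 * A i j.
  apply: eq_bigr => i _; rewrite mxE mulr_sumr; apply: eq_bigr => j _.
  by rewrite mulrA mulrAC.
have iMij i j : P.-integrable setT (fun w => (u i 0 * u j 0 * M w i j)%:E).
  by under eq_fun do rewrite EFinM; exact: integrableZl.
rewrite quadE -sumEFin.
transitivity (\int[P]_w (\sum_i \sum_j (u i 0 * u j 0 * M w i j)%:E))%E.
  apply: eq_integral => w _; rewrite quadE -sumEFin.
  by apply: eq_bigr => i _; rewrite -sumEFin.
rewrite integral_sum//; last by move=> i; exact: integrable_sum.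
apply: eq_bigr => i _; rewrite integral_sum// -sumEFin.
apply: eq_bigr => j _; under eq_integral do rewrite EFinM.
rewrite integralZl// mxE [RHS]EFinM unlock fineK//.
exact: integrable_fin_num.
Qed.

Lemma second_moment_sym {R : realType} n d (X : 'M[R]_(n, d)) :
  (second_moment X)^T = second_moment X.
Proof. by rewrite /second_moment linearZ /= trmx_mul trmxK. Qed.

Lemma second_moment_quadratic {R : realType} n d (X : 'M[R]_(n, d)) u :
  inner u (second_moment X *m u) =
    n%:R^-1 * \sum_i inner (row i X)^T u ^+ 2.
Proof.
rewrite /second_moment -scalemxAl innerZr -mulmxA inner_mulmx trmxK.
congr (_ * _); apply: eq_bigr => i _; rewrite expr2.
suff -> : inner (row i X)^T u = (X *m u) i 0 by [].
by rewrite innerE trmxK -row_mul mxE.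
Qed.

(** [lambda_le_quadratic] applies to A <= (1 + b) B and, when b < 1, to B <= (1 - b)^-1 A. *)
Lemma lambda_relative_error {R : realType} d (A B : 'M[R]_d) (b : R) (i : 'I_d) :
  psd A -> psd B -> 0 <= b ->
  (forall u, `|inner u (A *m u) - inner u (B *m u)| <= b * inner u (B *m u)) ->
  `|lambda A i - lambda B i| <= b * lambda B i.
Proof.
move=> pA pB b0 AB; have [AT _] := pA; have [BT _] := pB.
have lA := lambda_ge0 i pA; have lB := lambda_ge0 i pB.
have AB' u : (1 - b) * inner u (B *m u) <= inner u (A *m u) /\
    inner u (A *m u) <= (1 + b) * inner u (B *m u).
  have := AB u; move: (inner _ _) (inner u (B *m u)) => x y.
  by rewrite ler_norml => /andP[? ?]; split; lra.
have up : lambda A i <= (1 + b) * lambda B i + 0.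
  apply: lambda_le_quadratic => //; first by rewrite addr_ge0.
  by move=> u; rewrite mul0r addr0; case: (AB' u).
have lo : b < 1 -> lambda B i <= (1 - b)^-1 * lambda A i + 0.
  rewrite -subr_gt0 => b1; apply: lambda_le_quadratic => //.
    by rewrite invr_ge0 ltW.
  by move=> u; rewrite mul0r addr0 ler_pdivlMl//; case: (AB' u).
move: (lambda A i) (lambda B i) lA lB up lo => x y x0 y0 up lo.
rewrite ler_norml; apply/andP; split; last by lra.
(* For b >= 1 the lower bound only uses that A is positive semidefinite. *)
have [b1|b1] := leP 1 b.
  have yb : y <= b * y by rewrite ler_peMl.
  by lra.
have b1' : 0 < 1 - b by rewrite subr_gt0.
by move: (lo b1); rewrite addr0 ler_pdivlMl//; lra.
Qed.

Lemma measurable_lambda_error dT (T : measurableType dT) (R : realType)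
    (P : probability T R) d (M : T -> 'M[R]_d) (l b : 'I_d -> R) :
  integrable_mx P M -> (forall w, (M w)^T = M w) ->
  measurable [set w | forall i, `|lambda (M w) i - l i| <= b i].
Proof.
move=> iM MT.
rewrite (_ : [set w | _] = \bigcap_(i in [set: 'I_d])
    (fun w => lambda (M w) i) @^-1` `[l i - b i, l i + b i]).
  apply: fin_bigcap_measurable => // i _; rewrite -[X in measurable X]setTI.
  have mlambda : measurable_fun setT (fun w => lambda (M w) i).
    apply: measurable_lambda => // j k.
    by apply/measurable_EFinP; have /integrableP[] := iM j k.
  exact: mlambda measurableT _ (measurable_itv _).
apply/seteqP; split => w /= H i; [move=> _|]; have := H i.
  by rewrite /= in_itv /= ler_norml => /andP[? ?]; apply/andP; split; lra.
move=> /(_ I); rewrite /= in_itv /= ler_norml => /andP[? ?].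
by apply/andP; split; lra.
Qed.

Theorem theorem7 (R : realType) :
  exists C : R, 0 < C /\
  forall (dT : measure_display) (T : measurableType dT) (P : probability T R)
         (n d : nat) (X : T -> 'M[R]_(n, d)),
    (d <= n)%N ->
    let x := fun (i : 'I_n) (w : T) => (row i (X w))^T in
    let Sigma_hat := fun w : T => second_moment (X w) in
    let Sigma := expect_mx P Sigma_hat in
    let z := fun (i : 'I_n) (w : T) => invmx (sqrtmx Sigma) *m x i w in
    let K := \big[Num.max/0]_(i < n) fine (psi2_norm P (z i)) in
    iid P x ->
    integrable_mx P Sigma_hat ->
    Sigma \in unitmx ->
    (forall i, integrable_mx P (x i) /\ expect_mx P (x i) = 0) ->
    (forall i, sub_gaussian P (z i)) ->
    forall t : R, 0 <= t ->
    let eps := Num.sqrt (d%:R / n%:R) + t / Num.sqrt n%:R in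
    let E := [set w : T | forall i : 'I_d,
      `|lambda (Sigma_hat w) i - lambda Sigma i|
        <= C * K ^+ 2 * lambda Sigma i * Num.max eps (eps ^+ 2)] in
    ((1 - 2 * expR (- (t ^+ 2)))%R%:E <= P E)%E.
Proof.
exists 960; split; first by rewrite ltr0n.
move=> dT T P n d X dn x Sigma_hat Sigma z K.
move=> [xmeas xindep _] iSigma Sunit _ zsub t t0.
lazy zeta; set eps := Num.sqrt _ + _; set E := [set w | _].
have Shat_sym w : (Sigma_hat w)^T = Sigma_hat w by exact: second_moment_sym.
have mE : measurable E by exact: measurable_lambda_error.
(* In dimension 0 the event is the whole space. Otherwise d <= n makes n positive. *)
have [d0|d0] := posnP d.
  have -> : E = setT.
    by apply/seteqP; split => // w _ i; have := ltn_ord i; rewrite {2}d0.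
  rewrite probability_setT lee_fin gerBl mulr_ge0// expR_ge0.
have n0 : (0 < n)%N by exact: leq_trans dn.
have nR : 0 < n%:R :> R by rewrite ltr0n.
have Shat_psd w : psd (Sigma_hat w).
  split=> // u; rewrite second_moment_quadratic mulr_ge0 ?invr_ge0 ?(ltW nR)//.
  by apply: sumr_ge0 => i _; exact: sqr_ge0.
(* Positivity passes from the sample matrices to their expectation, so [sqrtmx Sigma] is a genuine
   square root. *)
have Spsd : psd Sigma.
  split=> [|u].
    apply/matrixP => i j; rewrite !mxE; congr (fine (expectation _ _)).
    by apply/funext => w; rewrite -[in LHS]Shat_sym mxE.
  rewrite -lee_fin -expect_mx_quadratic//; apply: integral_ge0 => w _.
  by rewrite lee_fin; case: (Shat_psd w).
have [[ST _] SS] := sqrtmxP Spsd; set S := sqrtmx Sigma in ST SS.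
have Su : S \in unitmx by move: Sunit; rewrite -SS unitmx_mul => /andP[].
have iST : (invmx S)^T = invmx S by rewrite trmx_inv ST.
have inner_z i w u : inner (z i w) u = inner (x i w) (invmx S *m u).
  by rewrite innerC [RHS]innerC /z (inner_mulmx _ u) iST.
have mx i v : measurable_fun setT (fun w => inner (x i w) v).
  by move=> _ B mB; rewrite setTI; exact: (xmeas i _ (borel_preimage_inner v mB)).
have mz i j : measurable_fun setT (fun w => z i w j 0).
  rewrite (_ : (fun w => z i w j 0) =
      (fun w => inner (x i w) (invmx S *m delta_mx j 0))); first exact: mx.
  apply/funext => w; rewrite -inner_z innerC innerE trmx_delta -rowE.
  by rewrite [RHS]mxE.
have K0 : 0 <= K by rewrite /K; elim/big_rec: _ => // i y _ y0; rewrite le_max y0 orbT.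
(* [fine] sends both infinities to 0: the value +oo is excluded by sub-gaussianity, and -oo lies
   below any bound. *)
have zK i : (psi2_norm P (z i) <= K%:E)%E.
  have : (fine (psi2_norm P (z i)) <= K) by exact: le_bigmax.
  have := zsub i; rewrite /sub_gaussian; case: (psi2_norm P (z i)) => [r _|//|_ _].
    by rewrite lee_fin.
  exact: leNye.
(* With v = S^-1 u the sum is n times the expectation of v^T Sigma_hat v, that is n v^T S S v = n
   u^T u. *)
have iso u : (\sum_i \int[P]_w (inner (z i w) u ^+ 2)%:E =
    (n%:R * inner u u)%:E)%E.
  rewrite -ge0_integral_sum//; last 2 first.
  - move=> i; apply/measurable_EFinP/measurable_funX.
    by under eq_fun do rewrite inner_z; exact: mx.
  - by move=> i w _; rewrite lee_fin sqr_ge0.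
  set v := invmx S *m u.
  transitivity (\int[P]_w (n%:R%:E * (inner v (Sigma_hat w *m v))%:E))%E.
    apply: eq_integral => w _; rewrite -EFinM second_moment_quadratic.
    rewrite mulVKf ?gt_eqF// -sumEFin; apply: eq_bigr => i _.
    by rewrite inner_z.
  rewrite ge0_integralZl_EFin//; last first.
    apply/measurable_EFinP; under eq_fun do rewrite second_moment_quadratic.
    apply: measurable_funM => //; apply: measurable_sum => i.
    exact/measurable_funX/mx.
    by move=> w _; rewrite lee_fin; case: (Shat_psd w).
  rewrite expect_mx_quadratic// -EFinM -/Sigma -SS -mulmxA inner_mulmx ST.
  by rewrite /v mulKVmx.
have indep u (B : 'I_n -> set R) : (forall i, measurable (B i)) ->
    P [set w | forall i, B i (inner (z i w) u)] =
    (\prod_i P ((fun w => inner (z i w) u) @^-1` B i))%E.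
  move=> mB; pose B' i := (fun y : 'cV[R]_d => inner y (invmx S *m u)) @^-1` B i.
  have preE i : (fun w => inner (z i w) u) @^-1` B i = x i @^-1` B' i.
    by apply/seteqP; split => w; rewrite /B' /= inner_z.
  have := xindep [set: 'I_n]%SET B' (fun i => borel_preimage_inner _ (mB i)).
  rewrite (_ : [set w | forall i, i \in [set: 'I_n]%SET -> B' i (x i w)] =
      [set w | forall i, B i (inner (z i w) u)]); last first.
    apply/seteqP; split => w /= H i; last by move=> _; have := H i; rewrite inner_z.
    by rewrite inner_z; apply: H; rewrite inE.
  by move=> ->; apply: eq_big => [i|i _]; rewrite ?inE// preE.
have [G [mG PG GP]] := quadratic_concentration d0 n0 K0 t0 mz zK iso indep.
apply: (le_trans PG); apply: le_measure; rewrite ?inE// => w wG i.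
set b := 960 * K ^+ 2 * Num.max eps (eps ^+ 2).
have -> : 960 * K ^+ 2 * lambda Sigma i * Num.max eps (eps ^+ 2) =
    b * lambda Sigma i by rewrite /b mulrAC.
have b0 : 0 <= b.
  apply: mulr_ge0; last by rewrite le_max sqr_ge0 orbT.
  by apply: mulr_ge0; [exact: ler0n|exact: sqr_ge0].
apply: lambda_relative_error => // u.
(* The concentration bound is tested at S u, where the whitening cancels: <z_i, S u> = <x_i, u>. *)
have SuE : inner (S *m u) (S *m u) = inner u (Sigma *m u).
  by rewrite -{1}ST -inner_mulmx mulmxA SS.
have := GP w wG (S *m u); rewrite SuE -/b.
rewrite second_moment_quadratic.
by under eq_bigr do rewrite inner_z (mulKmx Su).
Qed.
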